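(* Let $(X,\Sigma,\mu)$ be a semi-finite measure space. (i) For every $1\le p<q<\infty$, $\sigma(L^\infty,L^1)\subseteq\sigma_p\subseteq\sigma_q\subseteq\tau(L^\infty,L^1)\subseteq\tau_\infty$ and $\tau_\mu\subseteq\sigma_p$, and, unless $L^\infty$ is finite-dimensional, all of these inclusions are proper. (ii) $\tau(L^\infty,L^1)\subseteq\tau_O(L^\infty)\subseteq\tau_\infty$, and $\tau_O(L^\infty)=\tau_\infty$ if and only if $L^\infty$ is finite-dimensional. (iii) If $(X,\Sigma,\mu)$ is $\sigma$-finite, then the restrictions of $\tau_\mu$ and $\tau_O(L^\infty)$ to bounded parts of $L^\infty$ are equal (i.e. for every norm-bounded $B\subseteq L^\infty$ the subspace topologies induced on $B$ coincide).
   Context: $L^\infty$ and $L^p$ are the real spaces of essentially bounded, resp. $p$-integrable, functions on $(X,\Sigma,\mu)$. Topologies on $L^\infty$: $\tau_\infty$ is the norm topology of $\|\cdot\|_\infty$; $\tau_\mu$ (convergence in measure on sets of finite measure) is the linear topology generated by the F-seminorms $\rho_E(f)=\int|f|\wedge\chi_E\,d\mu$, $E\in\Sigma$, $\mu(E)<\infty$; for $1\le p<\infty$, $\sigma_p$ is the locally convex topology generated by the seminorms $f\mapsto\|fg\|_p$, $g\in L^p$ (the strong operator topology of multiplication operators on $L^p$); $\sigma(L^\infty,L^1)$ and $\tau(L^\infty,L^1)$ are the weak and Mackey topologies of the duality $\langle f,g\rangle=\int fg\,d\mu$. $\tau_O(L^\infty)$ is the order topology of the Riesz space $L^\infty$ (a.e.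 pointwise order): its closed sets are the sets $F$ such that no net in $F$ order converges to a point outside $F$, where $(x_\gamma)_{\gamma\in\Gamma}$ order converges to $x$ if there are nets $(y_\gamma)_{\gamma\in\Gamma}$ increasing with supremum $x$ and $(z_\gamma)_{\gamma\in\Gamma}$ decreasing with infimum $x$ with eventually $y_\gamma\le x_\gamma\le z_\gamma$. *)

(* Defs.v *)
From HB Require Import structures.
From mathcomp Require Import all_boot all_order all_algebra.
From mathcomp Require Import all_classical all_reals all_analysis.
Set Implicit Arguments. Unset Strict Implicit. Unset Printing Implicit Defensive.
Import Order.TTheory GRing.Theory Num.Theory.
Local Open Scope classical_set_scope.
Local Open Scope ring_scope.

(* Elements of L^oo, L^p are represented by their (measurable) representatives;
   every "open set" below is automatically saturated w.r.t. a.e. equality, so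
   topologies on these sets of representatives correspond exactly to the
   topologies on the quotient spaces. *)

Definition semi_finite d (T : measurableType d) (R : realType)
    (mu : {measure set T -> \bar R}) : Prop :=
  forall A, measurable A -> mu A = +oo%E ->
    exists B, [/\ measurable B, B `<=` A, (0 < mu B)%E & (mu B < +oo)%E].

Section Linf_topologies.
Context d (T : measurableType d) (R : realType) (mu : {measure set T -> \bar R}).
Local Open Scope ereal_scope.

Definition normInf (f : T -> R) : \bar R := 'N[mu]_(+oo)[EFin \o f].

Definition Linf : set (T -> R) :=
  [set f | measurable_fun setT f /\ normInf f < +oo].

Definition Lp (p : R) : set (T -> R) :=
  [set g | measurable_fun setT g /\ 'N[mu]_(p%:E)[EFin \o g] < +oo].

Definition L1 : set (T -> R) := [set g | mu.-integrable setT (EFin \o g)].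

Definition pairing (f g : T -> R) : \bar R := \int[mu]_x (f x * g x)%R%:E.

(* open sets of the (linear) topology on the set D generated by a family N
   of (F-)seminorms: U is open iff around each of its points it contains a
   basic neighbourhood {g | rho_i (g - f) < e, i < n}. *)
Definition gauge_open (D : set (T -> R)) (N : set ((T -> R) -> \bar R))
    (U : set (T -> R)) : Prop :=
  U `<=` D /\
  forall f, U f -> exists (n : nat) (rho : nat -> (T -> R) -> \bar R) (e : R),
    [/\ (0 < e)%R, (forall i, (i < n)%N -> N (rho i)) &
        forall g, D g -> (forall i, (i < n)%N -> rho i (fun x => (g x - f x)%R) < e%:E) ->
          U g].

Definition tau_inf : set (set (T -> R)) := gauge_open Linf [set normInf].

(* tau_mu : convergence in measure on sets of finite measure *)
Definition tau_mu : set (set (T -> R)) :=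
  gauge_open Linf [set rho | exists E, [/\ measurable E, mu E < +oo &
     rho = fun h => \int[mu]_x (Num.min `|h x| (\1_E x))%R%:E]].

(* sigma_p : strong operator topology of multiplication operators on L^p *)
Definition sigma_p (p : R) : set (set (T -> R)) :=
  gauge_open Linf [set rho | exists g, Lp p g /\
     rho = fun h => 'N[mu]_(p%:E)[(fun x => (h x * g x)%R%:E)]].

Definition weak_inf : set (set (T -> R)) :=
  gauge_open Linf [set rho | exists g, L1 g /\ rho = fun h => `|pairing h g|].

Definition weak_one : set (set (T -> R)) :=
  gauge_open L1 [set rho | exists f, Linf f /\ rho = fun h => `|pairing f h|].

Definition abs_convex (K : set (T -> R)) : Prop :=
  forall g h (a b : R), K g -> K h -> (`|a| + `|b| <= 1)%R ->
    K (fun x => (a * g x + b * h x)%R).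

Definition weak_one_compact (K : set (T -> R)) : Prop :=
  K `<=` L1 /\
  forall C : set (set (T -> R)), C `<=` weak_one ->
    K `<=` \bigcup_(U in C) U ->
    exists (n : nat) (Us : nat -> set (T -> R)),
      (forall k, (k < n)%N -> C (Us k)) /\ K `<=` \bigcup_(k in `I_n) Us k.

Definition mackey : set (set (T -> R)) :=
  gauge_open Linf [set rho | exists K, [/\ weak_one_compact K, abs_convex K &
     rho = fun h => ereal_sup [set `|pairing h g| | g in K]]].

Definition ae_le (f g : T -> R) : Prop := {ae mu, forall x, (f x <= g x)%R}.

Definition directed_preorder (I : Type) (le : I -> I -> Prop) : Prop :=
  [/\ inhabited I, (forall i, le i i),
      (forall i j k, le i j -> le j k -> le i k) &
      (forall i j, exists k, le i k /\ le j k)].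

Definition is_sup_Linf (I : Type) (y : I -> T -> R) (l : T -> R) : Prop :=
  [/\ Linf l, (forall i, ae_le (y i) l) &
      forall z, Linf z -> (forall i, ae_le (y i) z) -> ae_le l z].

Definition is_inf_Linf (I : Type) (y : I -> T -> R) (l : T -> R) : Prop :=
  [/\ Linf l, (forall i, ae_le l (y i)) &
      forall z, Linf z -> (forall i, ae_le z (y i)) -> ae_le z l].

Definition order_cvg (I : Type) (le : I -> I -> Prop) (x : I -> T -> R)
    (l : T -> R) : Prop :=
  exists (y z : I -> T -> R),
    [/\ (forall i, Linf (y i) /\ Linf (z i)),
        (forall i j, le i j -> ae_le (y i) (y j) /\ ae_le (z j) (z i)),
        is_sup_Linf y l, is_inf_Linf z l &
        exists i0, forall i, le i0 i -> ae_le (y i) (x i) /\ ae_le (x i) (z i)].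

Definition order_closed (F : set (T -> R)) : Prop :=
  F `<=` Linf /\
  forall (I : Type) (le : I -> I -> Prop) (x : I -> T -> R) (l : T -> R),
    directed_preorder le -> (forall i, F (x i)) -> Linf l ->
    order_cvg le x l -> F l.

Definition tau_O : set (set (T -> R)) :=
  [set U | U `<=` Linf /\ order_closed (Linf `\` U)].

Definition Linf_findim : Prop :=
  exists (n : nat) (e : 'I_n -> T -> R), (forall i, Linf (e i)) /\
    forall f, Linf f -> exists c : 'I_n -> R,
      {ae mu, forall x, f x = (\sum_(i < n) c i * e i x)%R}.

Definition Linf_bounded (B : set (T -> R)) : Prop :=
  B `<=` Linf /\ exists M : R, forall f, B f -> normInf f <= M%:E.

End Linf_topologies.

Definition coarser (U : Type) (t1 t2 : set (set U)) : Prop := t1 `<=` t2.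
Definition strictly_coarser (U : Type) (t1 t2 : set (set U)) : Prop :=
  t1 `<=` t2 /\ ~ (t2 `<=` t1).

Definition trace_top (U : Type) (t : set (set U)) (B : set U) : set (set U) :=
  [set V | exists O, t O /\ V = O `&` B].

(* Main.v *)
Require Import Defs.
From HB Require Import structures.
From mathcomp Require Import all_boot all_order all_algebra.
From mathcomp Require Import all_classical all_reals all_analysis.
From mathcomp Require Import lra ess_sup_inf measurable_realfun.
Import Order.TTheory GRing.Theory Num.Theory.
Import numFieldNormedType.Exports.
Local Open Scope classical_set_scope.
Local Open Scope ring_scope.
Set Implicit Arguments. Unset Strict Implicit. Unset Printing Implicit Defensive.

(** All gauges are compared with the modular [h |-> \int |h|^p w], [0 <= w] in
    [L^1], which for [w = |g|^p] is the [p]-th power of the seminorm of [g] in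
    [sigma_p]; the interpolation [|h|^p <= a + c |h|^q] then makes [sigma_p]
    coarser than [sigma_q].  For [q > 1] the polar of the modular
    [\int |h|^q w + 1] is weakly compact in [L^1] (ultrafilter limits of the
    pairing are represented by Radon-Nikodym), and testing [h] against
    [sgn h |t h|^(q-1) w] shows that it controls the modular; hence [sigma_q] is
    coarser than the Mackey topology.

    An order convergent net in [L^oo] converges uniformly on every weakly compact
    subset of [L^1]: otherwise a gliding hump produces functions [v_m] with
    [\sum |v_m|] bounded and [g_m] in the compact set with [\int v_m g_m] bounded
    away from 0, against Schur's theorem in [l^1].  So the Mackey topology is
    coarser than [tau_O].

    Either [X] is a finite union of atoms up to a null set, in which case [L^oo]
    is finite-dimensional and [tau_oo] is coarser than [sigma_1], or there is an
    infinite disjoint sequence of sets of finite positive measure, whose indicators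
    separate the topologies.  On bounded parts of the [L^oo] of a sigma-finite space, a sequence converging fast enough in
    measure converges almost everywhere, hence in order. *)

(** * Essentially bounded and integrable representatives *)

(** The measure need not be sigma-finite, so neither Radon-Nikodym nor a reduction of order bounded
    nets to sequences is at hand on the whole space. Both are recovered relative to one weight [w]
    in L^1: the set [0 < w] is a countable union of sets of finite measure, and integration against
    [w] sees nothing outside it. A net decreasing to its infimum is thus followed along a sequence
    chosen for [w], and a limit functional bounded by a modular of [w] has its density on [0 < w].

    One weight at a time gives only convergence against each single [g]; the gliding hump is what
    makes it uniform over a weakly compact set. Compactness is used through cluster points of
    sequences: one for the sequence that is tested, and a second one for the selected subsequence,
    because the function summing the humps is built only after the selection.

    For strictness the source of all quantities is the harmonic series: no integrable weight can
    have mass at least [e / (n + 2)] on every member of a disjoint sequence. *)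

Section Integrals.
Context d (T : measurableType d) (R : realType) (mu : {measure set T -> \bar R}).
Implicit Types (f g h w : T -> R) (A : set T).

(** The case split follows the norm at [+oo], which takes a default value when [mu setT] is 0; every
    set is then negligible, so any bound holds almost everywhere. *)
Lemma LinfP f : Linf mu f <-> measurable_fun setT f /\
  exists2 M : R, 0 <= M & {ae mu, forall x, `|f x| <= M}.
Proof.
split=> [[mf]|[mf [M M0 fM]]].
  rewrite /normInf unlock; case: ifPn => [mu0 fy|mu0 _].
    have [M fM] := ess_supr_bounded fy; split=> //.
    exists (Num.max M 0); first by rewrite le_max lexx orbT.
    by apply: filterS fM => x /= fM; rewrite le_max fM.
  split=> //; exists 0 => //; exists setT; split => //.
  by apply/eqP; rewrite eq_le measure_ge0 andbT leNgt.
split=> //; rewrite /normInf unlock; case: ifPn => [mu0|]; last by rewrite ltry.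
by apply: (@le_lt_trans _ _ M%:E); [apply/ess_supP; exact: fM|rewrite ltry].
Qed.

Lemma normInf_leP f (M : R) : 0 <= M ->
  (normInf mu f <= M%:E)%E <-> {ae mu, forall x, `|f x| <= M}.
Proof.
move=> M0; rewrite /normInf unlock; case: ifPn => [mu0|mu0].
  by split=> [/ess_supP|fM]; [|apply/ess_supP; exact: fM].
split=> // _; exists setT; split => //.
by apply/eqP; rewrite eq_le measure_ge0 andbT leNgt.
Qed.

Lemma Linf_meas f : Linf mu f -> measurable_fun setT f.
Proof. by case. Qed.

Lemma Linf_cst (c : R) : Linf mu (fun=> c).
Proof. by apply/LinfP; split=> //; exists `|c| => //; exact: nearW. Qed.

Lemma Linf_bound f (M : R) : measurable_fun setT f -> (forall x, `|f x| <= M) ->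
  Linf mu f.
Proof.
move=> mf fM; apply/LinfP; split=> //; exists (Num.max M 0).
  by rewrite le_max lexx orbT.
by apply: nearW => x; rewrite le_max fM.
Qed.

Lemma Linf_indic A : measurable A -> Linf mu \1_A.
Proof.
move=> mA; apply: (@Linf_bound _ 1); first exact: measurable_indic.
by move=> x; rewrite indicE; case: (x \in A); rewrite ?normr1 ?normr0.
Qed.

Lemma Linf_le f g : measurable_fun setT f -> Linf mu g ->
  {ae mu, forall x, `|f x| <= `|g x|} -> Linf mu f.
Proof.
move=> mf /LinfP[mg [M M0 gM]] fg; apply/LinfP; split=> //; exists M => //.
by apply: filterS2 gM fg => x gM fg; exact: le_trans gM.
Qed.

Lemma LinfD f g : Linf mu f -> Linf mu g -> Linf mu (fun x => f x + g x).
Proof.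
move=> /LinfP[mf [M M0 fM]] /LinfP[mg [N N0 gN]]; apply/LinfP; split.
  exact: measurable_funD.
exists (M + N); first exact: addr_ge0.
apply: filterS2 fM gN => x fM gN.
by rewrite (le_trans (ler_normD _ _))// lerD.
Qed.

Lemma LinfM f g : Linf mu f -> Linf mu g -> Linf mu (fun x => f x * g x).
Proof.
move=> /LinfP[mf [M M0 fM]] /LinfP[mg [N N0 gN]]; apply/LinfP; split.
  exact: measurable_funM.
exists (M * N); first exact: mulr_ge0.
apply: filterS2 fM gN => x fM gN.
by rewrite normrM ler_pM.
Qed.

Lemma LinfZ (c : R) f : Linf mu f -> Linf mu (fun x => c * f x).
Proof. by move=> Lf; apply: LinfM => //; exact: Linf_cst. Qed.

Lemma LinfN f : Linf mu f -> Linf mu (fun x => - f x).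
Proof.
move=> /LinfP[mf [M M0 fM]]; apply/LinfP; split; first exact: measurable_funN.
by exists M => //; apply: filterS fM => x; rewrite normrN.
Qed.

Lemma LinfB f g : Linf mu f -> Linf mu g -> Linf mu (fun x => f x - g x).
Proof. by move=> Lf Lg; apply: LinfD => //; exact: LinfN. Qed.

Lemma Linf_norm f : Linf mu f -> Linf mu (fun x => `|f x|).
Proof.
move=> Lf; apply: (Linf_le _ Lf).
  by apply: measurableT_comp => //; exact: Linf_meas Lf.
by apply: nearW => x; rewrite normr_id.
Qed.

Lemma Linf_sum (I : Type) (s : seq I) (F : I -> T -> R) :
  (forall i, Linf mu (F i)) -> Linf mu (fun x => \sum_(i <- s) F i x).
Proof.
move=> LF; elim: s => [|i s IH].
  by under eq_fun do rewrite big_nil; exact: Linf_cst.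
by under eq_fun do rewrite big_cons; exact: LinfD.
Qed.

Lemma Linf_powR (p : R) f : 0 <= p -> Linf mu f ->
  Linf mu (fun x => `|f x| `^ p).
Proof.
move=> p0 /LinfP[mf [M M0 fM]]; apply/LinfP; split.
  apply: (measurableT_comp (measurable_powR p)).
  exact: measurableT_comp.
exists (M `^ p); first exact: powR_ge0.
apply: filterS fM => x fM.
by rewrite ger0_norm ?powR_ge0// ge0_ler_powR ?nnegrE.
Qed.

Lemma L1_meas f : L1 mu f -> measurable_fun setT f.
Proof. by move=> /measurable_int/measurable_EFinP. Qed.

Lemma L1_ae_le f g : measurable_fun setT f -> L1 mu g ->
  {ae mu, forall x, `|f x| <= `|g x|} -> L1 mu f.
Proof.
move=> mf Lg fg; apply/integrableP; split; first exact/measurable_EFinP.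
have /integrableP[mg] := Lg; apply: le_lt_trans.
apply: ae_ge0_le_integral => //.
- by apply: measurableT_comp => //; exact/measurable_EFinP.
- exact: measurableT_comp.
- by apply: filterS fg => x fg _ /=; rewrite lee_fin.
Qed.

Lemma L1_le f g : measurable_fun setT f -> L1 mu g ->
  (forall x, `|f x| <= `|g x|) -> L1 mu f.
Proof. by move=> mf Lg fg; apply: L1_ae_le Lg _ => //; exact: nearW. Qed.

Lemma L1_indic A : measurable A -> (mu A < +oo)%E -> L1 mu \1_A.
Proof.
move=> mA Aoo; apply/integrableP; split.
  by apply/measurable_EFinP; exact: measurable_indic.
under eq_integral do rewrite /= ger0_norm//.
by rewrite integral_indic// setIT.
Qed.

Lemma L1D f g : L1 mu f -> L1 mu g -> L1 mu (fun x => f x + g x).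
Proof. by move=> Lf Lg; rewrite /L1 /=; have := integrableD measurableT Lf Lg. Qed.

Lemma L1Z (c : R) f : L1 mu f -> L1 mu (fun x => c * f x).
Proof. by move=> Lf; have := integrableZl measurableT c Lf. Qed.

Lemma L1B f g : L1 mu f -> L1 mu g -> L1 mu (fun x => f x - g x).
Proof. by move=> Lf Lg; have := integrableB measurableT Lf Lg. Qed.

Lemma L1_norm f : L1 mu f -> L1 mu (fun x => `|f x|).
Proof. exact: integrable_norm. Qed.

Lemma L1_cst0 : L1 mu (fun=> 0).
Proof. exact: integrable0. Qed.

Lemma L1_sum (I : Type) (s : seq I) (F : I -> T -> R) :
  (forall i, L1 mu (F i)) -> L1 mu (fun x => \sum_(i <- s) F i x).
Proof.
move=> LF; elim: s => [|i s IH].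
  by under eq_fun do rewrite big_nil; exact: L1_cst0.
by under eq_fun do rewrite big_cons; exact: L1D.
Qed.

Lemma L1_mul f g : Linf mu f -> L1 mu g -> L1 mu (fun x => f x * g x).
Proof.
move=> /LinfP[mf [M M0 fM]] Lg.
apply: (@L1_ae_le _ (fun x => M * g x)).
- by apply: measurable_funM => //; exact: L1_meas.
- exact: L1Z.
- by apply: filterS fM => x fM; rewrite !normrM (ger0_norm M0) ler_wpM2r.
Qed.

Lemma L1E f : L1 mu f ->
  (\int[mu]_x (f x)%:E)%E = (\int[mu]_x f x)%:E.
Proof. by move=> Lf; rewrite /Rintegral fineK//; exact: integrable_fin_num Lf. Qed.

Lemma ae_le_Rintegral f g : L1 mu f -> L1 mu g ->
  {ae mu, forall x, f x <= g x} -> \int[mu]_x f x <= \int[mu]_x g x.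
Proof.
move=> Lf Lg fg.
rewrite -subr_ge0 -RintegralB// /Rintegral.
rewrite (@ae_eq_integral _ _ _ mu setT (EFin \o (fun x => `|g x - f x|)))//.
- by apply: fine_ge0; apply: integral_ge0 => x _ /=; rewrite lee_fin.
- by apply/measurable_EFinP; exact: L1_meas (L1B Lg Lf).
- by apply/measurable_EFinP; exact: L1_meas (L1_norm (L1B Lg Lf)).
- by apply: filterS fg => x fg _ /=; rewrite ger0_norm// subr_ge0.
Qed.

Lemma ae_eq_Rintegral f g : measurable_fun setT f -> measurable_fun setT g ->
  {ae mu, forall x, f x = g x} -> \int[mu]_x f x = \int[mu]_x g x.
Proof.
move=> mf mg fg; congr fine; apply: ae_eq_integral => //.
- exact/measurable_EFinP.
- exact/measurable_EFinP.
- by apply: filterS fg => x fg _ /=; rewrite fg.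
Qed.

(** Real-valued twin of [pairing]: estimates stay in [R], and [pairingE] carries them over for [f]
    in L^oo and [g] in L^1. *)
Definition pair_int f g : R := \int[mu]_x (f x * g x).

Lemma pairingE f g : Linf mu f -> L1 mu g -> pairing mu f g = (pair_int f g)%:E.
Proof. by move=> Lf Lg; rewrite /pairing (L1E (L1_mul Lf Lg)). Qed.

Lemma pair_intDl f g h : Linf mu f -> Linf mu g -> L1 mu h ->
  pair_int (fun x => f x + g x) h = pair_int f h + pair_int g h.
Proof.
move=> Lf Lg Lh; rewrite /pair_int; under eq_Rintegral do rewrite mulrDl.
by rewrite RintegralD//; exact: L1_mul.
Qed.

Lemma pair_intBl f g h : Linf mu f -> Linf mu g -> L1 mu h ->
  pair_int (fun x => f x - g x) h = pair_int f h - pair_int g h.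
Proof.
move=> Lf Lg Lh; rewrite /pair_int; under eq_Rintegral do rewrite mulrBl.
by rewrite RintegralB//; exact: L1_mul.
Qed.

Lemma pair_intZl (c : R) f h : Linf mu f -> L1 mu h ->
  pair_int (fun x => c * f x) h = c * pair_int f h.
Proof.
move=> Lf Lh; rewrite /pair_int; under eq_Rintegral do rewrite -mulrA.
by rewrite RintegralZl//; exact: L1_mul.
Qed.

Lemma pair_intDr f g h : Linf mu f -> L1 mu g -> L1 mu h ->
  pair_int f (fun x => g x + h x) = pair_int f g + pair_int f h.
Proof.
move=> Lf Lg Lh; rewrite /pair_int; under eq_Rintegral do rewrite mulrDr.
by rewrite RintegralD//; exact: L1_mul.
Qed.

Lemma pair_intBr f g h : Linf mu f -> L1 mu g -> L1 mu h ->
  pair_int f (fun x => g x - h x) = pair_int f g - pair_int f h.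
Proof.
move=> Lf Lg Lh; rewrite /pair_int; under eq_Rintegral do rewrite mulrBr.
by rewrite RintegralB//; exact: L1_mul.
Qed.

Lemma pair_intZr (c : R) f h : Linf mu f -> L1 mu h ->
  pair_int f (fun x => c * h x) = c * pair_int f h.
Proof.
move=> Lf Lh; rewrite /pair_int; under eq_Rintegral do rewrite mulrCA.
by rewrite RintegralZl//; exact: L1_mul.
Qed.

Lemma pair_int_suml (I : Type) (s : seq I) (F : I -> T -> R) h :
  (forall i, Linf mu (F i)) -> L1 mu h ->
  pair_int (fun x => \sum_(i <- s) F i x) h = \sum_(i <- s) pair_int (F i) h.
Proof.
move=> LF Lh; elim: s => [|i s IH].
  rewrite big_nil /pair_int; under eq_Rintegral do rewrite big_nil mul0r.
  by rewrite Rintegral_cst// mul0r.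
rewrite big_cons -IH -pair_intDl//; last exact: Linf_sum.
by congr pair_int; apply/funext => x; rewrite big_cons.
Qed.

Lemma norm_pair_int f g : Linf mu f -> L1 mu g ->
  `|pair_int f g| <= pair_int (fun x => `|f x|) (fun x => `|g x|).
Proof.
move=> Lf Lg; rewrite /pair_int (le_trans (le_normr_Rintegral _ _))//.
  exact: L1_mul.
by under eq_Rintegral do rewrite normrM.
Qed.

Lemma le_pair_int f g w : Linf mu f -> Linf mu g -> L1 mu w ->
  (forall x, 0 <= w x) -> {ae mu, forall x, f x <= g x} ->
  pair_int f w <= pair_int g w.
Proof.
move=> Lf Lg Lw w0 fg; apply: ae_le_Rintegral; try exact: L1_mul.
by apply: filterS fg => x fg; rewrite ler_wpM2r.
Qed.

Lemma pair_int_ge0 f w : (forall x, 0 <= f x) -> (forall x, 0 <= w x) ->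
  0 <= pair_int f w.
Proof. by move=> f0 w0; apply: Rintegral_ge0 => x _; exact: mulr_ge0. Qed.

Lemma le_pair_intr f w w' : Linf mu f -> L1 mu w -> L1 mu w' ->
  (forall x, 0 <= f x) -> (forall x, w x <= w' x) ->
  pair_int f w <= pair_int f w'.
Proof.
move=> Lf Lw Lw' f0 ww'; apply: ae_le_Rintegral; try exact: L1_mul.
by apply: nearW => x; rewrite ler_wpM2l.
Qed.

End Integrals.

(** * Comparing topologies generated by gauges *)

Section Gauges.
Context d (T : measurableType d) (R : realType).
Implicit Types (D U : set (T -> R)) (N : set ((T -> R) -> \bar R)).

(** A basic neighbourhood involves finitely many gauges, so it suffices to control one gauge at a
    time and to take the minimum of the radii, started at 1 to cover an empty family. *)
Lemma gauge_open_coarser D N N' :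
  (forall f g, D f -> D g -> D (fun x => g x - f x)) ->
  (forall rho, N rho -> forall e : R, 0 < e -> exists rho', N' rho' /\
     exists2 e' : R, 0 < e' & forall h, D h -> (rho' h < e'%:E)%E ->
       (rho h < e%:E)%E) ->
  gauge_open D N `<=` gauge_open D N'.
Proof.
move=> DB NN' U [UD Uo]; split=> // f Uf.
have [n [rho [e [e0 Nrho UU]]]] := Uo _ Uf.
have /choice[r' r'P] : forall i : nat, exists r : ((T -> R) -> \bar R) * R,
    (i < n)%N -> [/\ N' r.1, 0 < r.2 & forall h, D h -> (r.1 h < r.2%:E)%E ->
       (rho i h < e%:E)%E].
  move=> i; case: (ltnP i n) => [ilt|_]; last by exists (rho i, 0).
  by have [r [Nr [e' e'0 rP]]] := NN' _ (Nrho i ilt) _ e0; exists (r, e').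
exists n, (fun i => (r' i).1), (\big[Num.min/1]_(i < n) (r' i).2); split.
- elim/big_ind: _ => // [x y x0 y0|i _]; first by rewrite lt_min x0.
  by have [] := r'P i (ltn_ord i).
- by move=> i /r'P[].
- move=> g Dg gr; apply: UU => // i ilt.
  have [_ _ rP] := r'P i ilt; apply: rP; first exact: DB (UD _ Uf) Dg.
  by apply: lt_le_trans (gr i ilt) _; rewrite lee_fin (bigmin_le _ (Ordinal ilt)).
Qed.

Lemma gauge_openS D N U : U `<=` D ->
  (forall f, U f -> exists rho, N rho /\ exists2 e : R, 0 < e &
     forall g, D g -> (rho (fun x => (g x - f x)%R) < e%:E)%E -> U g) ->
  gauge_open D N U.
Proof.
move=> UD Uo; split=> // f Uf; have [rho [Nr [e e0 rP]]] := Uo _ Uf.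
exists 1%N, (fun=> rho), e; split=> // g Dg gr.
by apply: rP => //; exact: (gr 0%N).
Qed.

(** Subadditivity around the centre [f0] makes the ball open; homogeneity does not enter, which is
    why the F-seminorms of [tau_mu] are covered as well. *)
Lemma gauge_ball_open D N rho f0 (e : R) : N rho ->
  (forall f g, D f -> D g -> (rho (fun x => (g x - f0 x)%R) <=
     rho (fun x => (f x - f0 x)%R) + rho (fun x => (g x - f x)%R))%E) ->
  (forall f, D f -> (0 <= rho (fun x => (f x - f0 x)%R))%E) ->
  gauge_open D N [set f | D f /\ (rho (fun x => (f x - f0 x)%R) < e%:E)%E].
Proof.
move=> Nr rD r0; apply: gauge_openS; first by move=> f [].
move=> f [Df rf]; exists rho; split=> //.
have rfin : rho (fun x => f x - f0 x) \is a fin_num.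
  by rewrite ge0_fin_numE ?r0// (lt_trans rf)// ltry.
exists (e - fine (rho (fun x => f x - f0 x))).
  by rewrite subr_gt0 -lte_fin fineK.
move=> g Dg rg; split=> //; apply: le_lt_trans (rD _ _ Df Dg) _.
by rewrite -(fineK rfin) addeC -lteBrDr// -EFinB.
Qed.

End Gauges.

(** * The modulars behind the topologies [sigma_p] *)

Section Seminorms.
Context d (T : measurableType d) (R : realType) (mu : {measure set T -> \bar R}).
Implicit Types (f g h w : T -> R) (A E : set T) (p q : R).

Definition pow_int p f w : R := pair_int mu (fun x => `|f x| `^ p) w.

Lemma Lnorm_mulE p h g : 0 < p -> Linf mu h -> L1 mu (fun x => `|g x| `^ p) ->
  ('N[mu]_(p%:E)[(fun x => (h x * g x)%R%:E)])%E =
  (pow_int p h (fun x => `|g x| `^ p) `^ p^-1)%:E.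
Proof.
move=> p0 Lh Lg; rewrite unlock -poweR_EFin; congr poweR.
rewrite -pairingE//; last by apply: Linf_powR => //; exact: ltW.
by apply: eq_integral => x _; rewrite -powRM// -normrM.
Qed.

Lemma Lp_L1 p g : 0 < p -> Lp mu p g -> L1 mu (fun x => `|g x| `^ p).
Proof.
move=> p0 [mg]; rewrite unlock => /lty_poweRy Ny; apply/integrableP; split.
  apply/measurable_EFinP; apply: (measurableT_comp (measurable_powR p)).
  exact: measurableT_comp.
under eq_integral do rewrite /= ger0_norm ?powR_ge0//.
by apply: Ny; rewrite gt_eqF// invr_gt0.
Qed.

Lemma L1_Lp p w : 0 < p -> (forall x, 0 <= w x) -> L1 mu w ->
  Lp mu p (fun x => w x `^ p^-1).
Proof.
move=> p0 w0 Lw; split.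
  by apply: (measurableT_comp (measurable_powR _)); exact: L1_meas Lw.
rewrite unlock poweR_lty//.
have /integrableP[_] := Lw.
under eq_integral do rewrite /= ger0_norm//.
under [X in _ -> (X < _)%E]eq_integral
  do rewrite /= ger0_norm ?powR_ge0// -powRrM mulVf ?gt_eqF// powRr1//.
by [].
Qed.

Lemma powRVK p w : 0 < p -> (forall x, 0 <= w x) ->
  (fun x => `|w x `^ p^-1| `^ p) = w.
Proof.
move=> p0 w0; apply/funext => x.
by rewrite ger0_norm ?powR_ge0// -powRrM mulVf ?gt_eqF// powRr1.
Qed.

Lemma powR_ltV p (a e : R) : 0 < p -> 0 <= a -> 0 <= e ->
  (a `^ p^-1 < e) = (a < e `^ p).
Proof.
move=> p0 a0 e0; have pV0 : 0 < p^-1 by rewrite invr_gt0.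
apply/idP/idP => h.
  have := gt0_ltr_powR p0 _ _ h; rewrite !nnegrE powR_ge0 e0 => /(_ isT isT).
  by rewrite -powRrM mulVf ?gt_eqF// powRr1.
have := gt0_ltr_powR pV0 _ _ h; rewrite !nnegrE powR_ge0 a0 => /(_ isT isT).
by rewrite -powRrM mulfV ?gt_eqF// powRr1.
Qed.

(** Finitely many seminorms merge into one modular: the weights [|g_i|^p] add up to a weight in L^1
    that dominates each of them. *)
Lemma sigma_pP p U : 0 < p -> sigma_p mu p U -> forall f, U f ->
  exists w, [/\ L1 mu w, forall x, 0 <= w x & exists2 e : R, 0 < e &
    forall g, Linf mu g -> pow_int p (fun x => g x - f x) w < e -> U g].
Proof.
move=> p0 [UL Uo] f Uf; have [n [rho [e [e0 Nrho UU]]]] := Uo _ Uf.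
have /choice[gs gsP] : forall i : 'I_n, exists g, Lp mu p g /\
     rho i = fun h => ('N[mu]_(p%:E)[(fun x => (h x * g x)%R%:E)])%E.
  by move=> i; exact: Nrho.
have Lg i : L1 mu (fun x => `|gs i x| `^ p) by apply: Lp_L1 => //; have [] := gsP i.
exists (fun x => \sum_(i < n) `|gs i x| `^ p); split.
- exact: (L1_sum _ Lg).
- by move=> x; apply: sumr_ge0 => i _; exact: powR_ge0.
exists (e `^ p); first exact: powR_gt0.
move=> g Lg' gw; apply: UU => // i ilt.
have Lgf : Linf mu (fun x => g x - f x) by apply: LinfB => //; exact: UL.
have -> := (gsP (Ordinal ilt)).2; rewrite Lnorm_mulE//.
rewrite lte_fin powR_ltV// ?(ltW e0)//; last first.
  by apply: pair_int_ge0 => x; exact: powR_ge0.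
apply: le_lt_trans gw; apply: le_pair_intr => //.
- by apply: Linf_powR => //; exact: ltW.
- exact: (L1_sum _ Lg).
- move=> x; rewrite (bigD1 (Ordinal ilt))//= lerDl.
  by apply: sumr_ge0 => j _; exact: powR_ge0.
Qed.

(** At radius 1 the modular and its [p]-th root, which is the seminorm of [w^(1/p)], have the same
    ball; Minkowski's inequality makes it open. *)
Lemma sigma_p_ball p w : 1 <= p -> L1 mu w -> (forall x, 0 <= w x) ->
  sigma_p mu p [set f | Linf mu f /\ pow_int p f w < 1].
Proof.
move=> p1 Lw w0; have p0 : 0 < p by exact: lt_le_trans p1.
pose rho := fun h => ('N[mu]_(p%:E)[(fun x => (h x * w x `^ p^-1)%R%:E)])%E.
have -> : [set f | Linf mu f /\ pow_int p f w < 1] =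
    [set f | Linf mu f /\ (rho (fun x => (f x - cst 0 x)%R) < 1%:E)%E].
  have E f : (fun x => f x - cst 0 x) = f by apply/funext => x; rewrite subr0.
  apply/seteqP; split => f [Lf] H; split=> //; move: H; rewrite E /rho;
    rewrite Lnorm_mulE// ?powRVK// lte_fin powR_ltV// ?powR1//;
    by apply: pair_int_ge0 => // x; exact: powR_ge0.
apply: gauge_ball_open => //.
- by exists (fun x => w x `^ p^-1); split=> //; exact: L1_Lp.
- move=> f g Lf Lg; rewrite addeC.
  have mw : measurable_fun setT (fun x => w x `^ p^-1).
    by apply: (measurableT_comp (measurable_powR _)); exact: L1_meas Lw.
  have := @minkowski_EFin _ _ _ mu (fun x => (g x - f x) * w x `^ p^-1)
    (fun x => (f x - cst 0 x) * w x `^ p^-1) p _ _ p1.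
  rewrite (_ : (fun x => _) \+ _ = (fun x => (g x - cst 0 x) * w x `^ p^-1)).
    apply; apply: measurable_funM => //.
      exact: Linf_meas (LinfB Lg Lf).
    by apply: Linf_meas (LinfB Lf _); exact: Linf_cst.
  by apply/funext => x /=; lra.
- by move=> f _; exact: Lnorm_ge0.
Qed.

(** The threshold [s = a^(1/p)] separates two regimes: below it [x^p <= a], above it
    [x^p = x^q / x^(q-p) <= x^q / s^(q-p)]. *)
Lemma powR_interp p q (a : R) : 0 < p -> p < q -> 0 < a ->
  exists2 c : R, 0 < c & forall x : R, 0 <= x -> x `^ p <= a + c * x `^ q.
Proof.
move=> p0 pq a0; pose s := a `^ p^-1; have s0 : 0 < s by exact: powR_gt0.
exists (s `^ (q - p))^-1; first by rewrite invr_gt0 powR_gt0.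
move=> x x0; case: (leP x s) => xs.
  apply: (@le_trans _ _ a); last first.
    by rewrite lerDl mulr_ge0// ?invr_ge0 powR_ge0.
  have <- : s `^ p = a by rewrite -powRrM mulVf ?gt_eqF// powRr1// ltW.
  by rewrite ge0_ler_powR// ?nnegrE ?ltW.
apply: (@le_trans _ _ ((s `^ (q - p))^-1 * x `^ q)); last by rewrite lerDr ltW.
rewrite mulrC ler_pdivlMr ?powR_gt0//.
have -> : x `^ q = x `^ p * x `^ (q - p).
  rewrite -powRD; first by congr powR; lra.
  by apply/implyP => _; rewrite gt_eqF// (lt_trans s0).
rewrite ler_wpM2l ?powR_ge0// ge0_ler_powR ?nnegrE//; last 2 first.
- exact: ltW.
- exact: ltW.
by rewrite subr_ge0 ltW.
Qed.

Lemma pow_int_interp p q w (e : R) : 0 < p -> p < q -> L1 mu w ->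
  (forall x, 0 <= w x) -> 0 < e ->
  exists2 e' : R, 0 < e' & forall h, Linf mu h -> pow_int q h w < e' ->
    pow_int p h w < e.
Proof.
move=> p0 pq Lw w0 e0; pose W := pair_int mu (fun=> 1) w.
have W0 : 0 <= W by apply: pair_int_ge0.
(* The constant term may cost [e / 2] in total against the mass [W] of [w]; adding 1 keeps the
   denominator positive when [W = 0]. *)
have a0 : 0 < e / 2 / (W + 1) by rewrite !divr_gt0// ltr_wpDl.
have [c c0 cP] := powR_interp p0 pq a0.
have q0 : 0 < q by exact: lt_trans pq.
exists (e / 2 / c); first by rewrite !divr_gt0.
move=> h Lh hq; have Lq : Linf mu (fun x => `|h x| `^ q).
  by apply: Linf_powR => //; exact: ltW.
apply: (@le_lt_trans _ _ (pair_int mu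
   (fun x => e / 2 / (W + 1) + c * `|h x| `^ q) w)).
  apply: le_pair_int => //.
  - by apply: Linf_powR => //; exact: ltW.
  - by apply: LinfD; [exact: Linf_cst|exact: LinfZ].
  - by apply: nearW => x; exact: cP.
rewrite pair_intDl//; [|exact: Linf_cst|exact: LinfZ].
rewrite (@pair_intZl _ _ _ _ c)// [X in _ < X](splitr e); apply: ler_ltD.
  have -> : pair_int mu (fun=> e / 2 / (W + 1)) w = e / 2 / (W + 1) * W.
    rewrite -(pair_intZl (e / 2 / (W + 1)) (Linf_cst mu 1) Lw).
    by congr pair_int; apply/funext => x; rewrite mulr1.
  rewrite -mulrA ler_piMr//; first by rewrite divr_ge0// ltW.
  by rewrite mulrC ler_pdivrMr ?ltr_wpDl// mul1r lerDl.
by rewrite mulrC -ltr_pdivlMr.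
Qed.

End Seminorms.

(** * Weak compactness and the Mackey topology *)

Section Ultra.
Context d (T : measurableType d) (R : realType) (mu : {measure set T -> \bar R}).
Implicit Types (f g h w : T -> R) (A E : set T).

Definition linear_on_Linf (L : (T -> R) -> R) : Prop :=
  (forall f g, Linf mu f -> Linf mu g ->
     L (fun x => f x + g x) = L f + L g) /\
  (forall (c : R) f, Linf mu f -> L (fun x => c * f x) = c * L f).

Lemma ultra_bounded_cvg (S : Type) (G : set_system S) (u : S -> R) (B : R) :
  UltraFilter G -> (\forall s \near G, `|u s| <= B) ->
  exists c : R, u s @[s --> G] --> c.
Proof.
move=> UG uB.
have co : compact `[-B, B]%classic by exact: segment_compact.
have uG : (u s @[s --> G]) `[-B, B]%classic.
  by apply: filterS uB => s /=; rewrite in_itv/= ler_norml.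
have [c [_ cc]] := co _ _ uG; exists c => N Nc.
case: (@in_ultra_setVsetC _ G (u @^-1` N) _) => // GN.
have [z [+ Nz]] := cc (~` N) N GN Nc.
by [].
Qed.

(* If no finite part of the cover works, an ultrafilter containing the complements
   of the finite unions converges to a functional, represented in [K] by [repr]. *)
Lemma pairing_compact (B : (T -> R) -> R) (K : set (T -> R)) :
  K `<=` L1 mu ->
  (forall f g, Linf mu f -> K g -> `|pair_int mu f g| <= B f) ->
  (forall L, linear_on_Linf L -> (forall f, Linf mu f -> `|L f| <= B f) ->
     exists2 g, K g & forall f, Linf mu f -> L f = pair_int mu f g) ->
  weak_one_compact mu K.
Proof.
move=> KL KB repr; split=> // C Cw KC; apply: contrapT => nofin.
pose F : set_system (T -> R) := [set S | exists (n : nat) (Us : nat -> set (T -> R)),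
  (forall k, (k < n)%N -> C (Us k)) /\ K `\` \bigcup_(k in `I_n) Us k `<=` S].
have PF : ProperFilter F.
  split.
    move=> [n [Us [CU KU]]]; apply: nofin; exists n, Us; split=> // g Kg.
    by apply: contrapT => ng; exact: (KU g).
  split.
  - by exists 0%N, (fun=> set0); split.
  - move=> P Q [n [Us [CU KU]]] [m [Vs [CV KV]]].
    exists (n + m)%N, (fun k => if (k < n)%N then Us k else Vs (k - n)%N); split.
      move=> k klt; case: ltnP => kn; first exact: CU.
      by apply: CV; rewrite ltn_subLR.
    move=> g [Kg ng]; split.
      apply: KU; split=> // -[k kn Ug]; apply: ng; exists k => /=.
        exact: ltn_addr.
      by rewrite (_ : (k < n)%N).
    apply: KV; split=> // -[k km Vg]; apply: ng; exists (n + k)%N => /=.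
      by rewrite ltn_add2l.
    by rewrite ltnNge leq_addr/= addKn.
  - move=> P Q PQ [n [Us [CU KU]]]; exists n, Us; split=> //.
    exact: subset_trans PQ.
have [G [UG FG]] := ultraFilterLemma PF.
have GK : G K by apply: FG; exists 0%N, (fun=> set0); split=> // g [].
have /choice[L LP] : forall f, exists c : R, Linf mu f ->
    pair_int mu f g @[g --> G] --> c.
  move=> f; have [Lf|nLf] := pselect (Linf mu f); last by exists 0.
  have [|c cP] := @ultra_bounded_cvg _ G (pair_int mu f) (B f) UG.
    by apply: filterS GK => g Kg; exact: KB.
  by exists c.
have lim_eq (u v : (T -> R) -> R) (a b : R) : u g @[g --> G] --> a ->
    v g @[g --> G] --> b -> (forall g, K g -> u g = v g) -> a = b.
  move=> ua vb uv; apply: (@cvg_unique _ (@Rhausdorff R) (u g @[g --> G])) => //.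
  apply: cvg_trans vb; apply: near_eq_cvg.
  by apply: filterS GK => g Kg; rewrite uv.
have Llin : linear_on_Linf L.
  split=> [f g Lf Lg|c f Lf].
    apply: (lim_eq _ _ _ _ (LP _ (LinfD Lf Lg)) (cvgD (LP _ Lf) (LP _ Lg))).
    by move=> k Kk; rewrite /= pair_intDl//; exact: KL.
  apply: (lim_eq _ _ _ _ (LP _ (LinfZ c Lf)) (cvgM (cvg_cst c) (LP _ Lf))).
  by move=> k Kk; rewrite /= pair_intZl//; exact: KL.
have LB f : Linf mu f -> `|L f| <= B f.
  move=> Lf; have /cvg_norm := LP _ Lf.
  move=> /cvgr_to_le; apply.
  by apply: filterS GK => g Kg; exact: KB.
have [g0 Kg0 Lg0] := repr _ Llin LB.
have [U CU Ug0] := KC _ Kg0.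
have [UL1 /(_ _ Ug0)[n [rho [e [e0 Nrho UU]]]]] := Cw _ CU.
(* Finitely many pairings converge along [G] to those of [g0], so the basic neighbourhood of [g0]
   inside [U] belongs to [G]. But [U] is itself a finite part of the cover, so [G] also contains its
   complement in [K]. *)
have GU : G U.
  have : \forall g \near G, forall i : 'I_n, (rho i (fun x => (g x - g0 x)%R) < e%:E)%E.
    apply: filter_forall => i; have [f [Lf ->]] := Nrho i (ltn_ord i).
    have /cvgrPdist_lt/(_ _ e0) := LP _ Lf; rewrite Lg0//.
    move=> nr; apply: filterS (filterI GK nr) => g [Kg] /=.
    rewrite pairingE//; last by apply: L1B; exact: KL.
    by rewrite pair_intBr; [rewrite distrC|..] => //; exact: KL.
  move=> nr; apply: filterS (filterI GK nr) => g [Kg gi].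
  by apply: UU; [exact: KL|move=> i ilt; exact: (gi (Ordinal ilt))].
have GnU : G (K `\` U).
  apply: FG; exists 1%N, (fun=> U); split=> // g [Kg nU]; split=> // Ug.
  by apply: nU; exists 0%N.
have GI : G (U `&` (K `\` U)) by exact: filterI.
by have /filter_ex[g [Ug [_ nU]]] := GI.
Qed.

End Ultra.

(** * Functionals that vanish on indicators *)

Section LinearOnLinf.
Context d (T : measurableType d) (R : realType) (mu : {measure set T -> \bar R}).
Implicit Types (f g h w : T -> R) (A E : set T).
Variable L : (T -> R) -> R.
Hypothesis Llin : linear_on_Linf mu L.

Lemma linear_on_Linf0 : L (fun=> 0) = 0.
Proof.
have [_ /(_ 0 _ (Linf_cst mu 0))] := Llin; rewrite [RHS]mul0r.
by apply: etrans; congr L; apply/funext => x; rewrite mul0r.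
Qed.

Lemma linear_on_LinfB f g : Linf mu f -> Linf mu g ->
  L (fun x => f x - g x) = L f - L g.
Proof.
move=> Lf Lg; have -> : (fun x => f x - g x) = (fun x => f x + -1 * g x).
  by apply/funext => x; rewrite mulN1r.
by rewrite Llin.1//; [rewrite Llin.2// mulN1r|exact: LinfZ].
Qed.

Lemma linear_on_Linf_sum n (F : 'I_n -> T -> R) : (forall i, Linf mu (F i)) ->
  L (fun x => \sum_(i < n) F i x) = \sum_(i < n) L (F i).
Proof.
move=> LF; elim: (index_enum _) => [|i s IH].
  under eq_fun do rewrite big_nil.
  by rewrite linear_on_Linf0 big_nil.
under eq_fun do rewrite big_cons.
by rewrite Llin.1// ?IH ?big_cons//; exact: Linf_sum.
Qed.

Lemma sum_ord_lt (m n : nat) : (m <= n)%N ->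
  \sum_(k < n) (k < m)%N%:R = m%:R :> R.
Proof.
move=> mn; rewrite -natr_sum; congr (_%:R).
rewrite -[RHS](minn_idPl mn) {mn}; elim: n => [|n IH].
  by rewrite big_ord0 minn0.
rewrite big_ord_recr/= IH; case: (ltnP n m) => nm /=.
  by rewrite (minn_idPr nm) addn1.
by rewrite addn0 (minn_idPl (leqW nm)).
Qed.

(** The sum counts the integers from 1 to [n] that are at most [n y]; as [y <= 1], it is the integer
    part of [n y] divided by [n]. *)
Lemma step_approx (n : nat) (y : R) : (0 < n)%N -> 0 <= y <= 1 ->
  `|y - \sum_(k < n) n%:R^-1 * ((k.+1)%:R <= n%:R * y)%R%:R| <= n%:R^-1.
Proof.
move=> n0 /andP[y0 y1]; have n0' : 0 < n%:R :> R by rewrite ltr0n.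
have ny0 : 0 <= n%:R * y by rewrite mulr_ge0.
have /andP[h1 h2] := truncn_itv ny0.
set m := Num.truncn (n%:R * y) in h1 h2.
have mn : (m <= n)%N.
  by rewrite -(ler_nat R) (le_trans h1)// ler_piMr.
rewrite -mulr_sumr (_ : \sum_(k < n) _ = m%:R); last first.
  rewrite -(sum_ord_lt mn); apply: eq_bigr => k _; congr ((_ : bool)%:R).
  apply/idP/idP => [kn|km]; last by rewrite (le_trans _ h1)// ler_nat.
  by have := le_lt_trans kn h2; rewrite ltr_nat ltnS.
have -> : y - n%:R^-1 * m%:R = n%:R^-1 * (n%:R * y - m%:R).
  by rewrite mulrBr mulrA mulVf ?gt_eqF// mul1r.
have nV0 : 0 <= n%:R^-1 :> R by rewrite invr_ge0 ltW.
rewrite normrM (ger0_norm nV0) ler_piMr// ger0_norm ?subr_ge0//.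
by rewrite lerBlDl ltW ?natr1 ?nat1r.
Qed.

(* A function [g] with values in [0, 1] is the uniform limit of the averages over
   [1 <= k <= n] of the indicators of [n g >= k]. *)
Lemma linear_on_Linf_ext (C : R) :
  (forall f (e : R), 0 < e -> Linf mu f ->
     {ae mu, forall x, `|f x| <= e} -> `|L f| <= C * e) ->
  (forall A, measurable A -> L \1_A = 0) ->
  forall f, Linf mu f -> L f = 0.
Proof.
move=> LC L1 f /[dup] Lf /LinfP[mf [M0 M00 fM0]].
have C0 : 0 <= C.
  have h : `|L (fun=> 0)| <= C * 1.
    apply: LC => //; first exact: Linf_cst.
    by apply: nearW => x; rewrite normr0.
  by rewrite mulr1 in h; exact: le_trans h.
have small (a : R) : (forall e : R, 0 < e -> `|a| <= C * e) -> a = 0.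
  move=> ae; apply/eqP; rewrite -normr_le0; apply/ler_addgt0Pl => e e0.
  rewrite addr0 (le_trans (ae (e / (C + 1)) _))//.
    by rewrite divr_gt0// ltr_wpDl.
  by rewrite mulrCA ler_piMr ?(ltW e0)// ler_pdivrMr ?mul1r ?ltr_wpDl// lerDl.
(* The 1 makes [M] positive, so that dividing by [2 M] is legitimate. Clipping to [[-M, M]] before
   rescaling puts [g] in [[0, 1]] everywhere, whereas [f] is bounded only almost everywhere. *)
pose M := M0 + 1; have M_gt0 : 0 < M by rewrite ltr_wpDl.
pose g x := (Num.min (Num.max (f x) (- M)) M + M) / (2 * M).
have MM : 0 < 2 * M by rewrite mulr_gt0.
have g01 x : 0 <= g x <= 1.
  apply/andP; split.
    rewrite divr_ge0 ?(ltW MM)// -lerBlDr sub0r le_min le_max lexx orbT/=.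
    by rewrite (le_trans _ (ltW M_gt0))// oppr_le0 ltW.
  by rewrite ler_pdivrMr// mul1r mulr_natl mulr2n lerD2r ge_min lexx orbT.
have mg : measurable_fun setT g.
  apply: measurable_funM => //; apply: measurable_funD => //.
  by apply: measurable_minr => //; exact: measurable_maxr.
have Lg : Linf mu g.
  apply: (@Linf_bound _ _ _ _ _ 1) => // x.
  by have /andP[? ?] := g01 x; rewrite ger0_norm.
have Lg0 : L g = 0.
  apply: small => e e0.
  have [n ne] : exists n, n.+1%:R^-1 < e.
    exists (Num.truncn e^-1); rewrite -[ltRHS]invrK ltf_pV2 ?posrE ?invr_gt0//.
    have e1 : 0 <= e^-1 by rewrite invr_ge0 ltW.
    by have /andP[] := truncn_itv e1.
  pose A (k : nat) := [set x | k.+1%:R <= n.+1%:R * g x].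
  have mA k : measurable (A k).
    rewrite -[A k]setTI; apply: measurable_fun_le => //.
    exact: measurable_funM.
  pose s x := \sum_(k < n.+1) n.+1%:R^-1 * (\1_(A k) x : R).
  have Ls : Linf mu s.
    by apply: Linf_sum => k; apply: LinfZ; exact: Linf_indic.
  have Ls0 : L s = 0.
    rewrite linear_on_Linf_sum; last by move=> k; apply: LinfZ; exact: Linf_indic.
    rewrite big1// => k _; rewrite Llin.2; last exact: Linf_indic.
    by rewrite L1// mulr0.
  rewrite -[L g]subr0 -Ls0 -linear_on_LinfB//.
  apply: LC => //; first exact: LinfB.
  apply: nearW => x; apply: le_trans (ltW ne).
  rewrite /s (eq_bigr (fun k : 'I_n.+1 => n.+1%:R^-1 * (k.+1%:R <= n.+1%:R * g x)%R%:R)).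
    exact: step_approx.
  by move=> k _; rewrite indicE (_ : (x \in A k) = (k.+1%:R <= n.+1%:R * g x))//;
    apply/idP/idP; rewrite inE.
have LM : L (fun=> M) = 0.
  have -> : (fun=> M) = (fun x => M * (\1_(@setT T) x : R)).
    by apply/funext => x; rewrite indicT mulr1.
  by rewrite Llin.2 ?L1 ?mulr0//; exact: Linf_indic.
have Lh : Linf mu (fun x => 2 * M * g x - M).
  by apply: LinfB; [exact: LinfZ|exact: Linf_cst].
have Lh0 : L (fun x => 2 * M * g x - M) = 0.
  rewrite linear_on_LinfB ?LM ?subr0 ?Llin.2 ?Lg0 ?mulr0//; first exact: LinfZ.
  exact: Linf_cst.
(* Here [f] and [2 M g - M] agree almost everywhere. The bound on [L], available for every [e > 0],
   is what makes [L] blind to null sets. *)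
apply: small => e e0; rewrite -[L f]subr0 -Lh0 -linear_on_LinfB//.
apply: LC => //; first exact: LinfB.
apply: filterS fM0 => x; rewrite ler_norml => /andP[fl fu].
have fl' : - M <= f x by rewrite (le_trans _ fl)// lerN2 lerDl.
have fu' : f x <= M by rewrite (le_trans fu)// lerDl.
rewrite /g (max_idPl fl') (min_idPl fu') mulrCA mulfV ?gt_eqF// mulr1 addrK.
by rewrite subrr normr0 ltW.
Qed.

End LinearOnLinf.

Lemma sum_indic_trivIset (T : Type) (R : numDomainType) (F : (set T)^nat) n x :
  trivIset setT F ->
  0 <= (\1_(\bigcup_i F i) x : R) - \sum_(i < n) (\1_(F i) x : R) <= 1.
Proof.
move=> tF; have [[i _ Fi]|nF] := pselect ((\bigcup_i F i) x); last first.
  rewrite big1 => [|i _].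
    by rewrite subr0 indicE memNset// lexx ler01.
  by rewrite indicE memNset// => Fi; apply: nF; exists i.
rewrite indicE mem_set; last by exists i.
have Fj j : (\1_(F j) x : R) = (j == i)%:R.
  rewrite indicE; congr ((_ : bool)%:R); apply/idP/eqP => [|->]; last first.
    by rewrite inE.
  rewrite inE => Fjx; apply: (tF _ _ I I).
  by exists x; split.
under eq_bigr do rewrite Fj.
have [ilt|ige] := ltnP i n; last first.
  rewrite big1 ?subr0 ?lexx ?ler01// => j _.
  by rewrite ltn_eqF// (leq_trans (ltn_ord j) ige).
rewrite (bigD1 (Ordinal ilt))//= eqxx big1 ?addr0 ?subrr ?lexx ?ler01// => j ji.
by rewrite (_ : (j == i :> nat) = false)//; apply/negbTE.
Qed.

(** * Radon-Nikodym representation of functionals bounded by a modular *)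

Section Representation.
Context d (T : measurableType d) (R : realType) (mu : {measure set T -> \bar R}).
Implicit Types (f g h : T -> R) (A E : set T).
Variables (q : R) (w : T -> R) (L : (T -> R) -> R).
Hypotheses (q1 : 1 < q) (Lw : L1 mu w) (w0 : forall x, 0 <= w x).
Hypothesis Llin : linear_on_Linf mu L.
Hypothesis LB : forall f, Linf mu f -> `|L f| <= pow_int mu q f w + 1.

Let q0 : 0 < q. Proof. exact: lt_trans q1. Qed.

(** Linearity of [L] turns the inhomogeneous bound into one bound for each [t]; a suitable [t] then
    replaces the norm inequality. *)
Let LB_scale f (t : R) : 0 < t -> Linf mu f ->
  `|L f| <= t^-1 * (pow_int mu q (fun x => t * f x) w + 1).
Proof.
move=> t0 Lf; rewrite -ler_pdivrMl ?invr_gt0// invrK.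
have -> : t * `|L f| = `|L (fun x => t * f x)|.
  by rewrite Llin.2// normrM gtr0_norm.
exact/LB/LinfZ.
Qed.

(** With [t = 2 / e] the scaled bound is below [e] as soon as the modular of [t f] is below 1; since
    [f^q <= f] on [[0, 1]], the radius [t^(-q)] ensures this. Countable additivity and absolute
    continuity of the charge both rest on this estimate. *)
Lemma dual_small (e : R) : 0 < e -> exists2 dl : R, 0 < dl &
  forall f, Linf mu f -> (forall x, 0 <= f x <= 1) -> pair_int mu f w < dl ->
    `|L f| < e.
Proof.
move=> e0; pose t := 2 / e; have t0 : 0 < t by rewrite divr_gt0.
exists (t `^ q)^-1; first by rewrite invr_gt0 powR_gt0.
move=> f Lf f01 fw; apply: le_lt_trans (LB_scale t0 Lf) _.
rewrite -ltr_pdivlMl ?invr_gt0// invrK.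
have -> : t * e = 1 + 1 by rewrite /t -mulrA mulVf ?gt_eqF// mulr1.
rewrite ltrD2r; apply: (@le_lt_trans _ _ (t `^ q * pair_int mu f w)).
  rewrite -(pair_intZl _ Lf Lw); apply: le_pair_int => //.
  - by apply: Linf_powR; [exact: ltW|exact: LinfZ].
  - exact: LinfZ.
  - apply: nearW => x; have /andP[f0 f1] := f01 x.
    rewrite normrM powRM// gtr0_norm// ler_wpM2l ?powR_ge0// ger0_norm//.
    have [->|fx0] := eqVneq (f x) 0; first by rewrite powR0// gt_eqF.
    by apply: ge1r_powR; [rewrite lt0r fx0 f0|exact: ltW].
by rewrite -ltr_pdivlMl ?powR_gt0// mulr1.
Qed.

Definition dual_charge A : \bar R := (L \1_A)%:E.

Let dual_charge0 : dual_charge set0 = 0%E.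
Proof. by rewrite /dual_charge indic0 (linear_on_Linf0 Llin). Qed.

Let dual_charge_fin A : measurable A -> dual_charge A \is a fin_num.
Proof. by []. Qed.

(** The remainder after [n] sets is an indicator whose integral against [w] tends to 0, because [w]
    has a countably additive integral; [dual_small] transfers this to [L]. *)
Let dual_charge_sigma_additive : semi_sigma_additive dual_charge.
Proof.
move=> F mF tF mUF.
have LF i : Linf mu \1_(F i) by exact: Linf_indic.
pose r n x := (\1_(\bigcup_i F i) x : R) - \sum_(i < n) (\1_(F i) x : R).
have Lr n : Linf mu (r n) by apply: LinfB; [exact: Linf_indic|exact: Linf_sum].
rewrite (_ : (fun n => _) = (fun n => (L \1_(\bigcup_i F i) - L (r n))%:E)); last first.
  apply/funext => n; rewrite sumEFin big_mkord -(linear_on_Linf_sum Llin LF).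
  rewrite /r (linear_on_LinfB Llin)//; [|exact: Linf_indic|exact: Linf_sum].
  by rewrite opprB addrC subrK.
apply/cvg_EFin; first by near=> n.
rewrite /comp/= -[X in _ --> X]subr0; apply: cvgB; first exact: cvg_cst.
apply/cvgrPdist_lt => e e0; have [dl dl0 dlP] := dual_small e0.
have Iw : (\sum_(0 <= i < n) \int[mu]_(x in F i) (w x)%:E)%E @[n --> \oo] -->
    (\int[mu]_(x in \bigcup_i F i) (w x)%:E)%E.
  by apply: semi_sigma_additive_nng_induced => //; exact: measurable_int Lw.
have IE A : measurable A ->
    (\int[mu]_(x in A) (w x)%:E)%E = (pair_int mu \1_A w)%:E.
  move=> mA; rewrite -pairingE//; last exact: Linf_indic.
  rewrite integral_mkcond; apply: eq_integral => x _.
  rewrite patchE indicE; case: ifPn => xA; first by rewrite mul1r.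
  by rewrite mul0r.
have {}Iw : \sum_(i < n) pair_int mu \1_(F i) w @[n --> \oo] -->
    pair_int mu \1_(\bigcup_i F i) w.
  move: Iw; rewrite IE// => /fine_cvgP[_]; apply: cvg_trans.
  apply: near_eq_cvg; near=> n; rewrite /= (eq_bigr _ (fun i _ => IE _ (mF i))).
  by rewrite sumEFin big_mkord.
move/cvgrPdist_lt : Iw => /(_ _ dl0); apply: filterS => n.
rewrite -pair_int_suml// -pair_intBl//; [|exact: Linf_indic|exact: Linf_sum].
have r01 x : 0 <= r n x <= 1 by exact: sum_indic_trivIset.
rewrite ger0_norm; last first.
  by apply: pair_int_ge0 => // x; have /andP[] := r01 x.
by move=> rw; rewrite sub0r normrN; apply: dlP.
Unshelve. all: by end_near. Qed.

HB.instance Definition _ := isCharge.Build _ _ _ dual_charge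
  dual_charge0 dual_charge_fin dual_charge_sigma_additive.

Definition supp := [set x | 0 < w x].

Lemma measurable_supp : measurable supp.
Proof.
have -> : supp = ~` [set x | w x <= 0].
  by apply/seteqP; split=> x; rewrite /supp /= ltNge => /negP.
apply: measurableC; rewrite -[X in measurable X]setTI.
by apply: measurable_fun_le => //; exact: L1_meas Lw.
Qed.

(** Restricting [mu] to the carrier of [w] gives the sigma-finite reference measure that
    Radon-Nikodym requires. *)
Definition supp_restr := mrestr mu measurable_supp.

HB.instance Definition _ := Measure.on supp_restr.

Lemma L1_indic_lty A : measurable A -> L1 mu \1_A -> (mu A < +oo)%E.
Proof.
move=> mA /integrableP[_]; under eq_integral do rewrite /= ger0_norm//.
by rewrite integral_indic// setIT.
Qed.

Let supp_restr_sigma_finite : sigma_finite setT supp_restr.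
Proof.
(* The complement of the carrier is null for the restricted measure, and integrability of [w] makes
   each set [w >= 1 / (n + 1)] of finite measure. *)
exists (fun n => ~` supp `|` [set x | n.+1%:R^-1 <= w x]).
  apply/seteqP; split=> // x _; have [wx|/negP wx] := boolP (0 < w x); last first.
    by exists 0%N => //; left.
  have e1 : 0 <= (w x)^-1 by rewrite invr_ge0 ltW.
  exists (Num.truncn (w x)^-1) => //; right => /=.
  rewrite -[leRHS]invrK lef_pV2 ?posrE ?invr_gt0//.
  by have /andP[_ /ltW] := truncn_itv e1.
move=> n; have mE : measurable [set x | n.+1%:R^-1 <= w x].
  rewrite -[X in measurable X]setTI.
  by apply: measurable_fun_le => //; exact: L1_meas Lw.
split; first by apply: measurableU => //; apply: measurableC; exact: measurable_supp.
rewrite /supp_restr /mrestr setIUl setICl set0U.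
apply: (@le_lt_trans _ _ (mu [set x | n.+1%:R^-1 <= w x])).
  by apply: le_measure; rewrite ?inE//; apply: measurableI => //; exact: measurable_supp.
apply: L1_indic_lty => //; apply: (L1_le _ (L1Z n.+1%:R Lw)).
  exact: measurable_indic.
move=> x; rewrite !ger0_norm//; last exact: mulr_ge0.
rewrite indicE; case: (boolP (x \in _)) => [|_]; last exact: mulr_ge0.
by rewrite inE /= => h; rewrite -ler_pdivrMl// mulr1.
Qed.

HB.instance Definition _ := Measure_isSigmaFinite.Build _ _ _ supp_restr
  supp_restr_sigma_finite.

(** A set that is null on the carrier has integral 0 against [w], hence lies below every threshold
    of [dual_small]. *)
Lemma dual_charge_dominated : dual_charge `<< supp_restr.
Proof.
apply/null_content_dominatesP => A mA; rewrite /= /supp_restr /mrestr => A0.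
congr EFin; apply/eqP; rewrite -normr_le0; apply/ler_addgt0Pl => e e0.
rewrite addr0; have [dl dl0 dlP] := dual_small e0.
apply/ltW/dlP; first exact: Linf_indic.
  by move=> x; rewrite indicE; case: (x \in A); rewrite ?lexx ?ler01.
suff -> : pair_int mu \1_A w = 0 by [].
rewrite /pair_int (@ae_eq_Rintegral _ _ _ mu _ (fun=> 0)) ?Rintegral_cst ?mul0r//.
  by apply: (@L1_meas _ _ _ mu); apply: L1_mul => //; exact: Linf_indic.
exists (A `&` supp); split => //.
  by apply: measurableI => //; exact: measurable_supp.
move=> x /= nx; apply: contrapT => nAS; apply: nx.
rewrite indicE; case: (boolP (x \in A)) => xA; last by rewrite mul0r.
rewrite mul1r; apply/eqP; rewrite eq_le w0 andbT leNgt; apply/negP => wx.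
by apply: nAS; split=> //; rewrite inE in xA.
Qed.

Let k := Radon_Nikodym dual_charge supp_restr.

Let kint : supp_restr.-integrable setT k.
Proof. exact/Radon_Nikodym_integrable/dual_charge_dominated. Qed.

Let int_suppE (f : T -> \bar R) A : A `<=` supp ->
  (\int[supp_restr]_(x in A) f x = \int[mu]_(x in A) f x)%E.
Proof.
move=> AS; apply: eq_measure_integral => B mB BA.
by rewrite /= /supp_restr /mrestr setIidl//; exact: subset_trans AS.
Qed.

(** The density [k] means nothing off the carrier; it is cut to 0 there so as to be integrable for
    [mu] itself. *)
Definition dual_repr x : R := fine (k x) * \1_supp x.

Let dual_reprE : EFin \o dual_repr = k \_ supp.
Proof.
apply/funext => x; rewrite patchE /= /dual_repr indicE.
case: (boolP (x \in supp)) => xS; last by rewrite mulr0.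
by rewrite mulr1 fineK//; apply/Radon_Nikodym_fin_num/dual_charge_dominated.
Qed.

Lemma L1_dual_repr : L1 mu dual_repr.
Proof.
have mS := measurable_supp.
rewrite /L1/= dual_reprE; apply/(integrable_mkcond _ mS).
have /integrableP[mk koo] := integrableS measurableT mS (subsetT _) kint.
by apply/integrableP; split=> //; rewrite -int_suppE.
Qed.

Lemma pair_dual_repr_indic A : measurable A -> pair_int mu \1_A dual_repr = L \1_A.
Proof.
move=> mA; have mS := measurable_supp; apply: EFin_inj.
rewrite -pairingE; [|exact: Linf_indic|exact: L1_dual_repr].
transitivity (\int[mu]_(x in A) (k \_ supp) x)%E.
  rewrite [RHS]integral_mkcond; apply: eq_integral => x _.
  rewrite patchE indicE -dual_reprE; case: ifPn => _; first by rewrite mul1r.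
  by rewrite mul0r.
rewrite -integral_mkcondr -int_suppE//.
rewrite -[RHS]/(dual_charge A).
rewrite (Radon_Nikodym_integral dual_charge_dominated mA).
rewrite (@negligible_integral _ _ _ supp_restr A (~` supp))//.
- by rewrite setDE setCK.
- exact: measurableC.
- exact: (integrableS measurableT mA).
- by change (mu (~` supp `&` supp) = 0%E); rewrite setICl measure0.
Qed.

Lemma dual_representation :
  exists2 g, L1 mu g & forall f, Linf mu f -> L f = pair_int mu f g.
Proof.
exists dual_repr; first exact: L1_dual_repr.
move=> f Lf; apply/eqP; rewrite -subr_eq0; apply/eqP.
have LG := L1_dual_repr.
(* The constant has two parts. If [|h| <= e], scaling by [t = 1 / e] makes the modular at most the
   mass of [w], so [|L h|] is at most [e] times that mass plus 1; the last summand is the L^1 norm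
   of [dual_repr]. *)
apply: (@linear_on_Linf_ext _ _ _ mu (fun f => L f - pair_int mu f dual_repr) _
  (pair_int mu (fun=> 1) w + 1 + pair_int mu (fun=> 1) (fun x => `|dual_repr x|))) => //.
- split=> [f1 f2 L1 L2|c f1 L1].
    by rewrite Llin.1// pair_intDl//; lra.
  by rewrite Llin.2// pair_intZl// mulrBr.
- move=> h e e0 Lh he.
  rewrite (le_trans (ler_normB _ _))// mulrDl lerD//.
    have eV0 : 0 < e^-1 by rewrite invr_gt0.
    apply: le_trans (LB_scale eV0 Lh) _; rewrite invrK mulrC.
    rewrite ler_wpM2r ?(ltW e0)// lerD2r; apply: le_pair_int => //.
    + by apply: Linf_powR; [exact: ltW|exact: LinfZ].
    + exact: Linf_cst.
    + apply: filterS he => x he; have -> : (1 : R) = 1 `^ q by rewrite powR1.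
      rewrite ge0_ler_powR ?nnegrE ?(ltW q0)//.
      by rewrite normrM (gtr0_norm eV0) ler_pdivrMl// mulr1.
  apply: le_trans (norm_pair_int Lh LG) _.
  rewrite mulrC -(pair_intZl _ (Linf_cst mu 1) (L1_norm LG)).
  apply: le_pair_int => //.
  + exact: Linf_norm.
  + by apply: LinfZ; exact: Linf_cst.
  + exact: L1_norm.
  + by apply: filterS he => x; rewrite mulr1.
- by move=> A mA; rewrite pair_dual_repr_indic// subrr.
Qed.

End Representation.

(** * Controlling modulars by weakly compact sets *)

Section SigmaMackey.
Context d (T : measurableType d) (R : realType) (mu : {measure set T -> \bar R}).
Implicit Types (f g h w : T -> R).

(* The modular plus 1, instead of the norm [(\int |f|^q w)^(1/q)], still bounds a
   weakly compact convex set and spares the conjugate exponent. *)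
Definition power_polar (q : R) w : set (T -> R) :=
  [set g | L1 mu g /\
    forall f, Linf mu f -> `|pair_int mu f g| <= pow_int mu q f w + 1].

Lemma power_polar_compact q w : 1 < q -> L1 mu w -> (forall x, 0 <= w x) ->
  weak_one_compact mu (power_polar q w).
Proof.
move=> q1 Lw w0; apply: (pairing_compact (B := fun f => pow_int mu q f w + 1)).
- by move=> g [].
- by move=> f g Lf [_]; exact.
- move=> L Llin LB; have [g Lg LE] := dual_representation q1 Lw w0 Llin LB.
  by exists g => //; split=> // f Lf; rewrite -LE//; exact: LB.
Qed.

Lemma power_polar_abs_convex q w : (forall x, 0 <= w x) ->
  abs_convex (power_polar q w).
Proof.
move=> w0 g h a b [Lg gP] [Lh hP] ab; split; first by apply: L1D; exact: L1Z.
move=> f Lf; rewrite pair_intDr//; [|exact: L1Z..].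
rewrite !pair_intZr// (le_trans (ler_normD _ _))// !normrM.
have B0 : 0 <= pow_int mu q f w + 1.
  by apply: addr_ge0 => //; apply: pair_int_ge0 => // x; exact: powR_ge0.
apply: (@le_trans _ _ ((`|a| + `|b|) * (pow_int mu q f w + 1))).
  by rewrite mulrDl lerD// ler_wpM2l//; [exact: gP|exact: hP].
by rewrite ler_piMl.
Qed.

(** A crude Young inequality: the product is at most the [q]-th power of the larger of [a] and
    [b]. *)
Lemma young_powR (a b q : R) : 0 <= a -> 0 <= b -> 1 < q ->
  a * b `^ (q - 1) <= a `^ q + b `^ q.
Proof.
move=> a0 b0 q1; have q0 : 0 < q by exact: lt_trans q1.
have [ab|/ltW ba] := leP a b.
  apply: (@le_trans _ _ (b `^ q)); last by rewrite lerDr powR_ge0.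
  by rewrite -(mulr_powRB1 b0 q0) ler_wpM2r ?powR_ge0.
apply: (@le_trans _ _ (a `^ q)); last by rewrite lerDl powR_ge0.
rewrite -(mulr_powRB1 a0 q0) ler_wpM2l// ge0_ler_powR ?nnegrE//.
by rewrite subr_ge0 ltW.
Qed.

Lemma power_polar_dual q w h (e : R) : 1 < q -> L1 mu w -> (forall x, 0 <= w x) ->
  Linf mu h -> 0 < e <= 1 -> e <= pow_int mu q h w ->
  exists2 g, power_polar q w g & e <= pair_int mu h g.
Proof.
move=> q1 Lw w0 Lh /andP[e0 e1] eI; have q0 : 0 < q by exact: lt_trans q1.
set I := pow_int mu q h w in eI; have I0 : 0 < I by exact: lt_le_trans eI.
(* This [t] makes the modular of [t h] exactly [e]. As [e <= 1], Young's inequality then places the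
   test function in the polar, and its pairing with [h] is [e / t >= e] because [t <= 1]. *)
pose t := (e / I) `^ q^-1; have t0 : 0 < t by rewrite powR_gt0// divr_gt0.
have tq : t `^ q = e / I.
  by rewrite -powRrM mulVf ?gt_eqF// powRr1// divr_ge0 ?ltW.
have t1 : t <= 1.
  have -> : (1 : R) = 1 `^ q^-1 by rewrite powR1.
  rewrite ge0_ler_powR ?nnegrE ?invr_ge0 ?(ltW q0)//.
    by rewrite divr_ge0// ltW.
  by rewrite ler_pdivrMr// mul1r.
pose s x : R := 2 * \1_([set x | 0 <= h x]) x - 1.
have mh : measurable [set x | 0 <= h x].
  rewrite -[X in measurable X]setTI.
  by apply: measurable_fun_le => //; exact: Linf_meas Lh.
have Ls : Linf mu s.
  by apply: LinfB; [apply: LinfZ; exact: Linf_indic|exact: Linf_cst].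
have s1 x : `|s x| = 1.
  rewrite /s indicE; case: (x \in _) => /=.
    by rewrite (_ : 2 * 1 - 1 = 1) ?normr1//; lra.
  by rewrite mulr0 sub0r normrN1.
have sh x : s x * h x = `|h x|.
  rewrite /s indicE; have [h0|h0] := leP 0 (h x).
    by rewrite mem_set// ger0_norm//=; lra.
  by rewrite memNset/=; [rewrite ltr0_norm//; lra|apply/negP; rewrite -ltNge].
have Lth : Linf mu (fun x => t * h x) by exact: LinfZ.
pose b x := `|t * h x| `^ (q - 1).
have Lb : Linf mu b by apply: Linf_powR => //; rewrite subr_ge0 ltW.
have Ltq : Linf mu (fun x => `|t * h x| `^ q) by apply: Linf_powR => //; exact: ltW.
have thI : pair_int mu (fun x => `|t * h x| `^ q) w = e.
  transitivity (t `^ q * I); last by rewrite tq -mulrA mulVf ?mulr1// gt_eqF.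
  rewrite /I /pow_int -pair_intZl//; last by apply: Linf_powR => //; exact: ltW.
  congr pair_int; apply/funext => x.
  by rewrite normrM powRM// (gtr0_norm t0).
exists (fun x => s x * (b x * w x)).
  split; first by apply: L1_mul => //; exact: L1_mul.
  move=> f Lf; apply: le_trans (norm_pair_int Lf _) _.
    by apply: L1_mul => //; exact: L1_mul.
  have -> : pair_int mu (fun x => `|f x|) (fun x => `|s x * (b x * w x)|) =
      pair_int mu (fun x => `|f x| * b x) w.
    congr Rintegral; apply/funext => x; rewrite normrM s1 mul1r.
    by rewrite ger0_norm ?mulrA// mulr_ge0// powR_ge0.
  apply: (@le_trans _ _ (pair_int mu (fun x => `|f x| `^ q + `|t * h x| `^ q) w)).
    apply: le_pair_int => //.
    - by apply: LinfM => //; exact: Linf_norm.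
    - by apply: LinfD => //; apply: Linf_powR => //; exact: ltW.
    - by apply: nearW => x; exact: young_powR.
  rewrite pair_intDl//; last by apply: Linf_powR => //; exact: ltW.
  by rewrite thI lerD2l.
have -> : pair_int mu h (fun x => s x * (b x * w x)) = t^-1 * e.
  rewrite -thI -pair_intZl//; congr Rintegral; apply/funext => x.
  rewrite mulrA (mulrC (h x)) sh mulrA; congr (_ * _).
  rewrite -(mulr_powRB1 (normr_ge0 _) q0) -/(b x) normrM (gtr0_norm t0).
  by rewrite !mulrA mulVf ?gt_eqF// mul1r.
by rewrite ler_pMl// invf_ge1.
Qed.

Lemma sigma_p_mackey q : 1 < q -> sigma_p mu q `<=` mackey mu.
Proof.
move=> q1; have q0 : 0 < q by exact: lt_trans q1.
apply: gauge_open_coarser; first by move=> f g Lf Lg; exact: LinfB.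
move=> rho [g [Lg ->]] e e0; have Lw := Lp_L1 q0 Lg.
set w := (fun x => _) in Lw; have w0 x : 0 <= w x by exact: powR_ge0.
(* The cap at 1 meets the condition [e <= 1] of [power_polar_dual]. *)
pose e2 := Num.min (e `^ q) 1.
have e20 : 0 < e2 by rewrite lt_min powR_gt0//=.
exists (fun h => ereal_sup [set (`|pairing mu h g|)%E | g in power_polar q w]); split.
  exists (power_polar q w); split=> //; first exact: power_polar_compact.
  exact: power_polar_abs_convex.
exists e2 => // h Lh hsup; rewrite Lnorm_mulE// lte_fin powR_ltV//; last first.
- exact: ltW.
- by apply: pair_int_ge0 => // x; exact: powR_ge0.
apply: (@lt_le_trans _ _ e2); last by rewrite ge_min lexx.
rewrite ltNge; apply/negP => /(power_polar_dual q1 Lw w0 Lh)[|k Kk ek].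
  by rewrite e20 ge_min lexx orbT.
move: hsup; apply/negP; rewrite -leNgt; apply: ereal_sup_ge.
exists (`|pairing mu h k|)%E; first by exists k.
have [Lk _] := Kk; rewrite pairingE //= lee_fin (le_trans ek)//; exact: ler_norm.
Qed.

End SigmaMackey.

(** * The elementary inclusions *)

Section Inclusions.
Context d (T : measurableType d) (R : realType) (mu : {measure set T -> \bar R}).
Implicit Types (f g h w : T -> R) (p q : R).

Lemma Lnorm_mul_powRV q h w : 0 < q -> Linf mu h -> L1 mu w -> (forall x, 0 <= w x) ->
  ('N[mu]_(q%:E)[(fun x => (h x * w x `^ q^-1)%R%:E)])%E =
  (pow_int mu q h w `^ q^-1)%:E.
Proof.
move=> q0 Lh Lw w0; rewrite -{2}(powRVK q0 w0); apply: Lnorm_mulE => //.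
by rewrite (powRVK q0 w0).
Qed.

Lemma sigma_p_mono p q : 0 < p -> p <= q -> sigma_p mu p `<=` sigma_p mu q.
Proof.
move=> p0; rewrite le_eqVlt => /predU1P[->//|pq].
have q0 : 0 < q by exact: lt_trans pq.
apply: gauge_open_coarser; first by move=> f g Lf Lg; exact: LinfB.
move=> rho [g [Lg ->]] e e0; have Lw := Lp_L1 p0 Lg.
set w := (fun x => _) in Lw; have w0 x : 0 <= w x by exact: powR_ge0.
have ep0 : 0 < e `^ p by exact: powR_gt0.
have [e' e'0 eP] := pow_int_interp p0 pq Lw w0 ep0.
exists (fun h => 'N[mu]_(q%:E)[(fun x => (h x * w x `^ q^-1)%R%:E)])%E; split.
  by exists (fun x => w x `^ q^-1); split=> //; exact: L1_Lp.
exists (e' `^ q^-1); first exact: powR_gt0.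
have pi0 r h : 0 <= pow_int mu r h w.
  by apply: pair_int_ge0 => // x; exact: powR_ge0.
move=> h Lh; rewrite (Lnorm_mulE p0 Lh Lw) -/w.
rewrite (Lnorm_mul_powRV q0 Lh Lw w0).
move=> hq; rewrite lte_fin; have {}hq : pow_int mu q h w `^ q^-1 < e' `^ q^-1.
  by rewrite -lte_fin.
rewrite (powR_ltV p0 (pi0 p h) (ltW e0)).
apply: eP => //; move: hq.
rewrite (powR_ltV q0 (pi0 q h) (powR_ge0 _ _)).
by rewrite -powRrM mulVf ?gt_eqF// (powRr1 (ltW e'0)).
Qed.

Lemma weak_inf_sigma_1 : weak_inf mu `<=` sigma_p mu 1.
Proof.
apply: gauge_open_coarser; first by move=> f g Lf Lg; exact: LinfB.
move=> rho [g [Lg ->]] e e0.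
exists (fun h => 'N[mu]_(1%:E)[(fun x => (h x * g x)%R%:E)])%E; split.
  exists g; split=> //; split; first exact: L1_meas Lg.
  by rewrite Lnorm1; have /integrableP[] := Lg.
exists e => // h Lh; apply: le_lt_trans; rewrite Lnorm1; apply: le_abse_integral => //.
by have /integrableP[] := L1_mul Lh Lg.
Qed.

Lemma L1_min_indic h (E : set T) : measurable_fun setT h -> measurable E ->
  (mu E < +oo)%E -> L1 mu (fun x => Num.min `|h x| (\1_E x)).
Proof.
move=> mh mE Eoo; apply: L1_le (L1_indic mE Eoo) _.
  apply: measurable_minr; first exact: measurableT_comp.
  exact: measurable_indic.
move=> x; have m0 : 0 <= Num.min `|h x| (\1_E x) by rewrite le_min normr_ge0 /=.
by rewrite (ger0_norm m0) [leRHS]ger0_norm// ge_min lexx orbT.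
Qed.

Lemma tau_mu_sigma_1 : tau_mu mu `<=` sigma_p mu 1.
Proof.
apply: gauge_open_coarser; first by move=> f g Lf Lg; exact: LinfB.
move=> rho [E [mE Eoo ->]] e e0.
exists (fun h => 'N[mu]_(1%:E)[(fun x => (h x * \1_E x)%R%:E)])%E; split.
  exists \1_E; split=> //; split; first exact: measurable_indic.
  by rewrite Lnorm1; have /integrableP[] := L1_indic mE Eoo.
exists e => // h Lh; apply: le_lt_trans; rewrite Lnorm1.
apply: ge0_le_integral => //.
- by have /integrableP[] := L1_min_indic (Linf_meas Lh) mE Eoo.
- apply: measurableT_comp => //; apply/measurable_EFinP.
  by apply: measurable_funM; [exact: Linf_meas Lh|exact: measurable_indic].
- move=> x _ /=; rewrite lee_fin normrM indicE.
  case: (x \in E); first by rewrite normr1 mulr1 ge_min lexx.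
  by rewrite normr0 mulr0 ge_min lexx orbT.
Qed.

Lemma tau_infP U : tau_inf mu U <-> U `<=` Linf mu /\
  forall f, U f -> exists2 e : R, 0 < e & forall g, Linf mu g ->
    {ae mu, forall x, `|g x - f x| <= e} -> U g.
Proof.
split=> [[UL Uo]|[UL Uo]].
  split=> // f Uf; have [n [rho [e [e0 Nrho UU]]]] := Uo _ Uf.
  exists (e / 2); first exact: divr_gt0.
  move=> g Lg ge; apply: UU => // i ilt; rewrite Nrho//.
  apply: (@le_lt_trans _ _ (e / 2)%:E); last by rewrite lte_fin ltr_pdivrMr// ltr_pMr// ltr1n.
  by apply/normInf_leP => //; rewrite divr_ge0// ltW.
apply: gauge_openS => // f Uf; have [e e0 eP] := Uo _ Uf.
exists (normInf mu); split=> //; exists e => // g Lg /ltW /normInf_leP ge.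
by apply: eP => //; apply: ge; exact: ltW.
Qed.

End Inclusions.

(** * The order topology *)

Section OrderConvergence.
Context d (T : measurableType d) (R : realType) (mu : {measure set T -> \bar R}).
Implicit Types (f g h w : T -> R).

Lemma pair_int_cvg (f_ : nat -> T -> R) f G w :
  (forall n, Linf mu (f_ n)) -> Linf mu f -> Linf mu G -> L1 mu w ->
  {ae mu, forall x, f_ n x @[n --> \oo] --> f x} ->
  {ae mu, forall x, forall n, `|f_ n x| <= G x} ->
  pair_int mu (f_ n) w @[n --> \oo] --> pair_int mu f w.
Proof.
move=> Lf_ Lf LG Lw f_f f_G.
have [||_ _ h] := @dominated_convergence _ T R mu setT measurableT
  (fun n x => (f_ n x * w x)%:E) (fun x => (f x * w x)%:E)
  (fun x => (G x * `|w x|)%:E)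
  (fun n => measurable_int mu (L1_mul (Lf_ n) Lw))
  (measurable_int mu (L1_mul Lf Lw)) _ (L1_mul LG (L1_norm Lw)) _.
- apply: filterS f_f => x fx _; apply: cvg_EFin; first by near=> n.
  by apply: cvgM => //; exact: cvg_cst.
- apply: filterS f_G => x fx n _; rewrite /= lee_fin normrM.
  by rewrite ler_wpM2r.
rewrite (L1E (L1_mul Lf Lw)) in h.
move/fine_cvgP : h => [_]; apply: cvg_trans; apply: near_eq_cvg; near=> n.
by rewrite /= (L1E (L1_mul (Lf_ n) Lw)).
Unshelve. all: by end_near. Qed.

(** The envelopes are [f - u n] and [f + u n]. Countably many almost everywhere inequalities hold
    off one null set, so supremum and infimum are decided pointwise. *)
Lemma order_cvg_seq (u x : nat -> T -> R) f : Linf mu f ->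
  (forall n, Linf mu (u n)) -> (forall n t, 0 <= u n t) ->
  (forall n m t, (n <= m)%N -> u m t <= u n t) ->
  {ae mu, forall t, forall e : R, 0 < e -> exists n, u n t < e} ->
  (forall n, {ae mu, forall t, `|x n t - f t| <= u n t}) ->
  order_cvg mu (fun n m => (n <= m)%N) x f.
Proof.
move=> Lf Lu u0 ud ulim xu.
exists (fun n t => f t - u n t), (fun n t => f t + u n t); split.
- by move=> n; split; [exact: LinfB|exact: LinfD].
- move=> n m nm; split; apply: nearW => t.
    by rewrite lerD2l lerN2 ud.
  by rewrite lerD2l ud.
- split=> // [n|z Lz zP]; first by apply: nearW => t; rewrite gerBl.
  apply: filterS2 ulim (ae_foralln zP) => t ut zt.
  apply/ler_addgt0Pr => e /ut[n ne]; rewrite -lerBlDr.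
  by apply: le_trans (zt n); rewrite lerD2l lerN2 ltW.
- split=> // [n|z Lz zP]; first by apply: nearW => t; rewrite lerDl.
  apply: filterS2 ulim (ae_foralln zP) => t ut zt.
  apply/ler_addgt0Pr => e /ut[n ne].
  by apply: le_trans (zt n) _; rewrite lerD2l ltW.
- exists 0%N => n _; split; apply: filterS (xu n) => t; rewrite ler_norml => /andP[h1 h2].
    by lra.
  by lra.
Qed.

Lemma directed_nat : directed_preorder (fun n m : nat => (n <= m)%N).
Proof.
split=> //; first exact: (inhabits 0%N).
  by move=> n m k nm; exact: leq_trans.
by move=> n m; exists (maxn n m); rewrite leq_maxl leq_maxr.
Qed.

(** The sequential consequence of order openness, sufficient to refute openness and to find a point
    of [U] on a sequence. *)
Lemma tau_OP U : tau_O mu U -> U `<=` Linf mu /\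
  forall (x : nat -> T -> R) f, U f -> (forall n, Linf mu (x n)) ->
    order_cvg mu (fun n m => (n <= m)%N) x f -> exists n, U (x n).
Proof.
move=> [UL [_ Uc]]; split=> // x f Uf Lx xf; apply: contrapT => nU.
have [] := Uc _ _ x f directed_nat _ (UL _ Uf) xf; last by [].
by move=> n; split=> // Ux; apply: nU; exists n.
Qed.

(** Points outside [U] at uniform distance at most [1 / (n + 1)] from [f] order converge to [f],
    with constants as gaps. *)
Lemma tau_O_tau_inf : tau_O mu `<=` tau_inf mu.
Proof.
move=> U /tau_OP[UL Uo]; apply/tau_infP; split=> // f Uf; apply: contrapT => ne.
have /choice[x xP] : forall n : nat, exists g, [/\ Linf mu g,
    {ae mu, forall t, `|g t - f t| <= n.+1%:R^-1} & ~ U g].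
  move=> n; apply: contrapT => ng; apply: ne; exists n.+1%:R^-1 => // g Lg gf.
  by apply: contrapT => nU; apply: ng; exists g.
have [] := Uo x f Uf; first by move=> n; have [] := xP n.
  apply: (@order_cvg_seq (fun n => fun=> n.+1%:R^-1)) => //.
  - exact: UL.
  - by move=> n; exact: Linf_cst.
  - by move=> n m t nm; rewrite lef_pV2 ?posrE ?ltr0n// ler_nat.
  - apply: nearW => t e e0; exists (Num.truncn e^-1).
    have e1 : 0 <= e^-1 by rewrite invr_ge0 ltW.
    rewrite -[ltRHS]invrK ltf_pV2 ?posrE ?invr_gt0//.
    by have /andP[] := truncn_itv e1.
  - by move=> n; have [] := xP n.
by move=> n; have [] := xP n.
Qed.

End OrderConvergence.

(** * Order continuity of integration against an L^1 weight *)

Section OrderContinuity.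
Context d (T : measurableType d) (R : realType) (mu : {measure set T -> \bar R}).
Implicit Types (f g h w : T -> R).

Lemma Linf_max f g : Linf mu f -> Linf mu g -> Linf mu (fun x => Num.max (f x) (g x)).
Proof.
move=> Lf Lg; apply: (Linf_le _ (LinfD (Linf_norm Lf) (Linf_norm Lg))).
  by apply: measurable_maxr; [exact: Linf_meas Lf|exact: Linf_meas Lg].
apply: nearW => x; rewrite (ger0_norm (addr_ge0 _ _))//.
by rewrite maxEle; case: ifP => _; rewrite ?lerDl ?lerDr.
Qed.

Lemma Linf_min f g : Linf mu f -> Linf mu g -> Linf mu (fun x => Num.min (f x) (g x)).
Proof.
move=> Lf Lg; apply: (Linf_le _ (LinfD (Linf_norm Lf) (Linf_norm Lg))).
  by apply: measurable_minr; [exact: Linf_meas Lf|exact: Linf_meas Lg].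
apply: nearW => x; rewrite (ger0_norm (addr_ge0 _ _))//.
by rewrite /Num.min; case: ifP => _; rewrite ?lerDl ?lerDr.
Qed.

Lemma pair_int_eq0 f w : Linf mu f -> L1 mu w -> (forall x, 0 <= f x) ->
  (forall x, 0 <= w x) -> pair_int mu f w = 0 -> {ae mu, forall x, f x * w x = 0}.
Proof.
move=> Lf Lw f0 w0 fw; have Lfw := L1_mul Lf Lw.
have mfw := measurable_int mu Lfw.
have : (\int[mu]_x `|(f x * w x)%:E| = 0)%E.
  under eq_integral do rewrite /= ger0_norm ?mulr_ge0//.
  by rewrite (L1E Lfw) [X in X%:E]fw.
move/(ae_eq_integral_abs mu measurableT mfw); apply: filterS => x /= /(_ I).
by move=> [].
Qed.

(** Let [al] be the infimum of the integrals. A decreasing sequence [v] built from indices nearly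
    attaining [al] has a pointwise limit [V] of integral at least [al]. On [0 < w] this [V] lies
    almost everywhere below each [z c]: otherwise meeting [v n] with [z c] would push an integral
    under [al]. So [V], replaced by [l] off the carrier, is a lower bound of the net, hence at most
    [l]. *)
Lemma is_inf_pair_int (I : Type) (le : I -> I -> Prop) (z : I -> T -> R) l w (e : R) :
  directed_preorder le -> (forall i, Linf mu (z i)) ->
  (forall i j, le i j -> ae_le mu (z j) (z i)) -> is_inf_Linf mu z l ->
  L1 mu w -> (forall x, 0 <= w x) -> 0 < e ->
  exists i, forall j, le i j -> pair_int mu (z j) w < pair_int mu l w + e.
Proof.
move=> [[i0] _ letr ledir] Lz zmono [Ll lz linf] Lw w0 e0.
pose E := [set pair_int mu (z i) w | i in setT]; pose al := inf E.
have Elb : lbound E (pair_int mu l w) by move=> _ [i _ <-]; exact: le_pair_int (lz i).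
have Einf : has_inf E by split; [exists (pair_int mu (z i0) w), i0|exists (pair_int mu l w)].
have alP i : al <= pair_int mu (z i) w by apply: (ge_inf Einf.2); exists i.
suff alpl : al <= pair_int mu l w.
  have [_ [i _ <-] ie] := inf_adherent e0 Einf; exists i => j ij.
  apply: le_lt_trans (le_pair_int (Lz j) (Lz i) Lw w0 (zmono _ _ ij)) _.
  by apply: lt_le_trans ie _; rewrite lerD2r.
have /choice[i_ i_P] : forall n : nat, exists i,
    pair_int mu (z i) w < al + n.+1%:R^-1.
  move=> n; have n0 : 0 < n.+1%:R^-1 :> R by [].
  by have [_ [i _ <-] ie] := inf_adherent n0 Einf; exists i.
(* The join with [l] keeps [v] above [l] at every point and not just almost everywhere, so the
   pointwise infimum [V] exists everywhere. *)
pose v := fix v n x := match n with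
  | 0%N => Num.max (z (i_ 0%N) x) (l x)
  | m.+1 => Num.min (v m x) (Num.max (z (i_ m.+1) x) (l x)) end.
have Lv n : Linf mu (v n).
  by elim: n => [|n IH]; [exact: Linf_max|apply: Linf_min => //; exact: Linf_max].
have lv n x : l x <= v n x.
  by elim: n => [|n IH] /=; rewrite ?le_min ?le_max ?lexx ?IH ?orbT.
have vd x : nonincreasing_seq (v ^~ x).
  by apply/nonincreasing_seqP => n; rewrite ge_min lexx.
have vz n : ae_le mu (v n) (z (i_ n)).
  apply: filterS (lz (i_ n)) => x lzx; case: n lzx => [|n] lzx /=.
    by rewrite (max_idPl lzx).
  by rewrite (max_idPl lzx) ge_min lexx orbT.
(* Directedness puts a member of the net below both [v n] and any given [z c]; integrals of such
   minima therefore never fall under [al]. *)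
have vk n c : exists k, ae_le mu (z k) (v n) /\ ae_le mu (z k) (z c).
  elim: n => [|n [k [kv kc]]].
    have [k [k1 k2]] := ledir (i_ 0%N) c; exists k; split; last exact: zmono.
    by apply: filterS (zmono _ _ k1) => x /= h; rewrite le_max h.
  have [k' [k1 k2]] := ledir (i_ n.+1) k; exists k'; split.
    apply: filterS3 (zmono _ _ k1) (zmono _ _ k2) kv => x /= h1 h2 h3.
    by rewrite le_min le_max h1 (le_trans h2).
  by apply: filterS2 (zmono _ _ k2) kc => x; exact: le_trans.
pose V x := inf (range (v ^~ x)).
have vV x : v ^~ x n @[n --> \oo] --> V x.
  apply: nonincreasing_cvgn => //; exists (l x) => _ [n _ <-]; exact: lv.
have lV x : l x <= V x.
  by apply: (cvgr_to_ge (vV x)); near=> n; exact: lv.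
have Vv n x : V x <= v n x.
  apply: ge_inf; first by exists (l x) => _ [m _ <-]; exact: lv.
  by exists n.
pose G x := `|l x| + `|v 0%N x|.
have LG : Linf mu G by apply: LinfD; exact: Linf_norm.
have sandwich x (a : R) : l x <= a -> a <= v 0%N x -> `|a| <= G x.
  move=> la av; have := ler_norm (- l x); rewrite normrN ler_norml /G => h1.
  have h2 := ler_norm (v 0%N x); have h3 := normr_ge0 (l x).
  by have h4 := normr_ge0 (v 0%N x); apply/andP; split; lra.
have mV : measurable_fun setT V.
  by apply: (measurable_fun_cvg (h := v)) => [n|x _]; [exact: Linf_meas (Lv n)|exact: vV].
have LV : Linf mu V.
  apply: (Linf_le mV LG); apply: nearW => x.
  by rewrite [leRHS]ger0_norm ?addr_ge0//; exact: sandwich.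
have alV : al <= pair_int mu V w.
  have /cvgr_to_ge : pair_int mu (v n) w @[n --> \oo] --> pair_int mu V w.
    apply: (pair_int_cvg Lv LV LG Lw); first by apply: nearW => x; exact: vV.
    by apply: nearW => x n; apply: sandwich => //; exact: vd.
  apply; near=> n; have [k [kv _]] := vk n i0.
  by apply: le_trans (alP k) _; exact: le_pair_int kv.
apply: le_trans alV _.
(* Off the carrier nothing relates [V] to the other members of the net, while [l] is below all of
   them by assumption; integrals against [w] do not notice the change. *)
pose m x := if 0 < w x then V x else l x.
have mm : measurable_fun setT m.
  apply: measurable_fun_ifT => //; last exact: Linf_meas Ll.
  by apply: measurable_fun_ltr => //; exact: L1_meas Lw.
have Lm : Linf mu m.
  apply: (Linf_le mm LG); apply: nearW => x.
  rewrite [leRHS]ger0_norm ?addr_ge0//; rewrite /m; case: ifP => _; apply: sandwich;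
    first [exact: lV|exact: (Vv 0%N)|exact: (lv 0%N)|by []].
have -> : pair_int mu V w = pair_int mu m w.
  congr Rintegral; apply/funext => x; rewrite /m; have := w0 x.
  by rewrite le_eqVlt => /predU1P[<-|->]//; rewrite !mulr0.
apply: le_pair_int => //; apply: linf => // c.
pose r x := Num.max (V x - z c x) 0.
have Lr : Linf mu r by apply: Linf_max; [exact: LinfB|exact: Linf_cst].
have r0 x : 0 <= r x by rewrite le_max lexx orbT.
have rw0 : pair_int mu r w = 0.
  apply/eqP; rewrite eq_le pair_int_ge0// andbT; apply/ler_addgt0Pl => eta eta0.
  rewrite addr0; pose n := Num.truncn eta^-1.
  have ne : n.+1%:R^-1 < eta.
    have e1 : 0 <= eta^-1 by rewrite invr_ge0 ltW.
    rewrite -[ltRHS]invrK ltf_pV2 ?posrE ?invr_gt0//.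
    by have /andP[] := truncn_itv e1.
  pose vm x := Num.min (v n x) (z c x).
  have Lvm : Linf mu vm by exact: Linf_min.
  apply: (@le_trans _ _ (pair_int mu (fun x => v n x - vm x) w)).
    apply: le_pair_int => //; first exact: LinfB.
    apply: nearW => x; rewrite /r ge_max subr_ge0 ge_min lexx/= andbT.
    by rewrite lerB// ?Vv// ge_min lexx orbT.
  rewrite pair_intBl// (le_trans _ (ltW ne))// lerBlDr addrC.
  apply: le_trans (_ : al + n.+1%:R^-1 <= _).
    apply/ltW/le_lt_trans/(i_P n); exact: le_pair_int (vz n).
  rewrite lerD2r; have [k [kv kc]] := vk n c; apply: le_trans (alP k) _.
  by apply: le_pair_int => //; apply: filterS2 kv kc => x h1 h2; rewrite le_min h1.
apply: filterS2 (pair_int_eq0 Lr Lw r0 w0 rw0) (lz c) => x rwx lzx.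
rewrite /m; case: ifPn => // wx; move/eqP: rwx; rewrite mulf_eq0 (gt_eqF wx) orbF.
by move=> /eqP rx; rewrite -subr_le0 -rx le_max lexx.
Unshelve. all: by end_near. Qed.

(** The gap [D = z - y] between the envelopes dominates the error. Its integrals tend to 0 by
    [is_inf_pair_int], applied to [z] and to [- y]. *)
Lemma order_cvg_dominated (I : Type) (le : I -> I -> Prop) (x : I -> T -> R) l :
  directed_preorder le -> order_cvg mu le x l ->
  exists D : I -> T -> R, [/\ forall i, Linf mu (D i),
    forall i, {ae mu, forall t, 0 <= D i t},
    forall i j, le i j -> ae_le mu (D j) (D i),
    exists i0, forall i, le i0 i -> {ae mu, forall t, `|x i t - l t| <= D i t} &
    forall w, L1 mu w -> (forall t, 0 <= w t) -> forall e : R, 0 < e ->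
      exists i, forall j, le i j -> pair_int mu (D j) w < e].
Proof.
move=> dI [y [z [Lyz yzmono [Ll yl lsup] [_ lz linf] [i0 i0P]]]].
have Ly i : Linf mu (y i) by have [] := Lyz i.
have Lz i : Linf mu (z i) by have [] := Lyz i.
exists (fun i t => z i t - y i t); split.
- by move=> i; exact: LinfB.
- move=> i; apply: filterS2 (yl i) (lz i) => t h1 h2.
  by rewrite subr_ge0 (le_trans h1).
- move=> i j /yzmono[h1 h2]; apply: filterS2 h1 h2 => t h1 h2; exact: lerB.
- exists i0 => i /i0P[h1 h2]; have h34 : {ae mu, forall t, y i t <= l t <= z i t}.
    by apply: filterS2 (yl i) (lz i) => t -> ->.
  apply: filterS3 h1 h2 h34 => t h1 h2 /andP[h3 h4].
  by rewrite ler_norml; apply/andP; split; lra.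
- move=> w Lw w0 e e0; have e2 : 0 < e / 2 by exact: divr_gt0.
  have [i iP] : exists i, forall j, le i j -> pair_int mu (z j) w < pair_int mu l w + e / 2.
    by apply: is_inf_pair_int => // i j /yzmono[].
  have [k kP] : exists i, forall j, le i j -> pair_int mu (fun t => - y j t) w <
      pair_int mu (fun t => - l t) w + e / 2.
    apply: (@is_inf_pair_int _ le (fun i t => - y i t)) => //.
    + by move=> j; exact: LinfN.
    + by move=> j j' /yzmono[+ _]; apply: filterS => t; rewrite lerN2.
    + split; first exact: LinfN.
        by move=> j; apply: filterS (yl j) => t; rewrite lerN2.
      move=> u Lu uP; have : ae_le mu l (fun t => - u t).
        apply: lsup; first exact: LinfN.
        by move=> j; apply: filterS (uP j) => t; rewrite lerNr.
      by apply: filterS => t; rewrite lerNr.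
  have [_ _ letr ledir] := dI; have [j [ij kj]] := ledir i k; exists j => j' jj'.
  have := iP _ (letr _ _ _ ij jj'); have := kP _ (letr _ _ _ kj jj').
  have N f : Linf mu f -> pair_int mu (fun t => - f t) w = - pair_int mu f w.
    move=> Lf; rewrite -mulN1r -pair_intZl//; congr pair_int.
    by apply/funext => t; rewrite mulN1r.
  by rewrite !N// pair_intBl//; lra.
Qed.

End OrderContinuity.

(** * Weakly compact sets and the gliding hump *)

Section WeakCompact.
Context d (T : measurableType d) (R : realType) (mu : {measure set T -> \bar R}).
Implicit Types (f g h w : T -> R) (K : set (T -> R)).

Lemma weak_one_nbhd k (fs : 'I_k -> T -> R) (e : R) g : (forall i, Linf mu (fs i)) ->
  L1 mu g -> weak_one mu
    [set h | L1 mu h /\ forall i, `|pair_int mu (fs i) (fun x => h x - g x)| < e].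
Proof.
move=> Lfs Lg; split=> [h []//|h [Lh hP]].
have [fs' fs'P] : exists fs' : nat -> T -> R, forall i : 'I_k, fs' i = fs i.
  exists (fun n => if insub n is Some i then fs i else fun=> 0) => i.
  by rewrite valK.
exists k, (fun n h => `|pairing mu (fs' n) h|)%E,
  (\big[Num.min/1]_(i < k) (e - `|pair_int mu (fs i) (fun x => h x - g x)|)); split.
- elim/big_ind: _ => // [x y x0 y0|i _]; first by rewrite lt_min x0.
  by rewrite subr_gt0.
- move=> n nk; exists (fs' n); split=> //.
  by rewrite (fs'P (Ordinal nk)).
- move=> h' Lh' h'P; split=> // i; have := h'P i (ltn_ord i).
  rewrite fs'P pairingE//; last exact: L1B.
  rewrite /= lte_fin => hi.
  have hi' : `|pair_int mu (fs i) (fun x => h' x - h x)| <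
      e - `|pair_int mu (fs i) (fun x => h x - g x)|.
    by apply: lt_le_trans hi _; exact: bigmin_le.
  have -> : (fun x => h' x - g x) = (fun x => (h' x - h x) + (h x - g x)).
    by apply/funext => x; rewrite addrA subrK.
  rewrite pair_intDr//; [|exact: L1B..].
  by rewrite (le_lt_trans (ler_normD _ _))// -ltrBrDr.
Qed.

(** Without a cluster point, the weakly open sets avoided by some tail of [g] would cover [K]; a
    finite subcover is avoided by [g] from the largest threshold on. *)
Lemma weak_one_compact_cluster K (g : nat -> T -> R) : weak_one_compact mu K ->
  (forall n, K (g n)) -> exists2 h, K h &
    forall k (fs : 'I_k -> T -> R) (e : R) N, (forall i, Linf mu (fs i)) -> 0 < e ->
      exists2 n, (N <= n)%N &
        forall i, `|pair_int mu (fs i) (fun x => g n x - h x)| < e.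
Proof.
move=> [KL Kc] Kg; apply: contrapT => nh.
pose C := [set U | weak_one mu U /\ exists N, forall n, (N <= n)%N -> ~ U (g n)].
have [|h Kh|n [Us [CU KU]]] := Kc C; first by move=> U [].
  apply: contrapT => nC; apply: nh; exists h => // k fs e N Lfs e0.
  apply: contrapT => nn; apply: nC.
  exists [set h' | L1 mu h' /\
      forall i, `|pair_int mu (fs i) (fun x => h' x - h x)| < e].
    split; first by apply: weak_one_nbhd => //; exact: KL.
    by exists N => n Nn [_ nP]; apply: nn; exists n.
  split=> [|i]; first exact: KL.
  have -> : (fun x => h x - h x) = (fun=> 0) by apply/funext => x; rewrite subrr.
  rewrite /pair_int; under eq_Rintegral do rewrite mulr0.
  by rewrite Rintegral_cst// mul0r normr0.
have /choice[N NP] : forall k, exists N, (k < n)%N ->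
    forall m, (N <= m)%N -> ~ Us k (g m).
  move=> k; have [kn|_] := ltnP k n; last by exists 0%N.
  by have [_ [N NP]] := CU _ kn; exists N.
have [k kn Uk] := KU _ (Kg (\max_(k < n) N k)%N).
by apply: (NP k kn _ _ Uk); rewrite (leq_bigmax (Ordinal kn)).
Qed.

(* Schur's theorem for the images [(pair_int (v m) g)_m] of [K] in l^1. *)
Lemma weak_one_compact_small K (v : nat -> T -> R) Z (g : nat -> T -> R) (e : R) :
  weak_one_compact mu K -> (forall n, Linf mu (v n)) -> Linf mu Z ->
  (forall N x, \sum_(m < N) `|v m x| <= Z x) -> (forall n, K (g n)) -> 0 < e ->
  exists n, `|pair_int mu (v n) (g n)| < e.
Proof.
move=> Kc Lv LZ vZ Kg e0; apply: contrapT => nvg.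
have {nvg} vg n : e <= `|pair_int mu (v n) (g n)|.
  by rewrite leNgt; apply/negP => h; apply: nvg; exists n.
have KL := Kc.1.
pose a h m := pair_int mu (fun x => `|v m x|) (fun x => `|h x|).
have a0 h m : 0 <= a h m by exact: pair_int_ge0.
have le_a h m : L1 mu h -> `|pair_int mu (v m) h| <= a h m.
  by move=> Lh; exact: norm_pair_int.
(* Since the sums of [|v m|] stay below [Z], the integrals [a h m] are summable in [m] for each
   fixed [h]. *)
have tail h (dl : R) : L1 mu h -> 0 < dl ->
    exists N, forall N' M, (N <= N')%N -> \sum_(N' <= m < M) a h m < dl.
  move=> Lh dl0; pose A N := \sum_(0 <= m < N) a h m.
  have AZ N : A N <= pair_int mu Z (fun x => `|h x|).
    rewrite /A big_mkord -pair_int_suml; last 2 first.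
    - by move=> i; exact: Linf_norm.
    - exact: L1_norm.
    apply: le_pair_int => //; first by apply: Linf_sum => i; exact: Linf_norm.
      exact: L1_norm.
    by apply: nearW => x.
  have supA : has_sup (range A).
    by split; [exists (A 0%N), 0%N|exists (pair_int mu Z (fun x => `|h x|)) => _ [N _ <-]].
  have [_ [N _ <-] AN] := sup_adherent dl0 supA; exists N => N' M NN'.
  have [MN'|/ltnW N'M] := leqP M N'; first by rewrite big_geq.
  have : A M <= sup (range A) by apply: (ub_le_sup supA.2); exists M.
  have AA : A N <= A N'.
    by rewrite /A (@big_cat_nat _ _ _ N 0 N')//= lerDl sumr_ge0.
  by rewrite {1}/A (@big_cat_nat _ _ _ N' 0 M)//= -/(A N'); lra.
have [h0 Kh0 h0P] := weak_one_compact_cluster Kc Kg.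
have Lh0 := KL _ Kh0; pose h n x := g n x - h0 x.
have Lg n : L1 mu (g n) by exact: KL.
have Lh n : L1 mu (h n) by exact: L1B.
have e8 : 0 < e / 8 by rewrite divr_gt0.
(* From [n0] on, replacing [g n] by [h n = g n - h0] costs less than [e / 4], so the diagonal
   pairings stay at least [3 e / 4]. *)
have [n0 n0P] := tail h0 (e / 4) Lh0 (divr_gt0 e0 (ltr0n _ 4)).
have vh n : (n0 <= n)%N -> e * 3 / 4 <= `|pair_int mu (v n) (h n)|.
  move=> n0n; have := n0P n n.+1 n0n; rewrite big_nat1 => an; have := le_a h0 n Lh0.
  rewrite /h pair_intBr//; have := vg n.
  have := lerB_dist (pair_int mu (v n) (g n)) (pair_int mu (v n) h0); lra.
(* The next index is so late that the [n + 1] earlier functions together contribute at most [e / 8]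
   against [h n'], hence the division by [n + 1], and the functions from [n'] on contribute less
   than [e / 8] against [h n]. *)
pose rel n n' := [/\ (n < n')%N,
  forall m, (m <= n)%N -> `|pair_int mu (v m) (h n')| < e / 8 / n.+1%:R &
  forall M, \sum_(n' <= m < M) a (h n) m < e / 8].
have relP n : {n' | rel n n'}.
  apply: cid; have [N NP] := tail (h n) _ (Lh n) e8.
  have en : 0 < e / 8 / n.+1%:R by rewrite divr_gt0.
  have [n' n'N n'P] := h0P n.+1 (fun i => v i) (e / 8 / n.+1%:R)
    (maxn n.+1 N) (fun i => Lv i) en.
  move: n'N; rewrite geq_max => /andP[nn' Nn'].
  exists n'; split=> // [m mn|M]; last exact: NP.
  exact: (n'P (Ordinal (mn : (m < n.+1)%N))).
have [nn [nn0 nnP]] := dependent_choice relP n0.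
have nnlt j : (nn j < nn j.+1)%N by have [] := nnP j.
have nnmono i j : (i <= j)%N -> (nn i <= nn j)%N.
  by move=> /subnK <-; elim: (j - i)%N => // k IH; rewrite addSn (leq_trans IH)// ltnW.
have nnj j : (j <= nn j)%N.
  by elim: j => // j IH; exact: leq_ltn_trans (nnlt j).
have nnn0 j : (n0 <= nn j)%N by rewrite -nn0 nnmono.
pose c m : R := (`[< exists j, nn j = m >])%:R.
have c01 m : 0 <= c m <= 1 by rewrite /c; case: asboolP; rewrite ?lexx ?ler01.
pose P M x := \sum_(m < M) c m * v m x.
have LP M : Linf mu (P M) by apply: Linf_sum => m; exact: LinfZ.
have PZ M x : `|P M x| <= Z x.
  apply: le_trans (vZ M x); apply: le_trans (ler_norm_sum _ _ _) _.
  apply: ler_sum => m _; have /andP[h1 h2] := c01 m.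
  by rewrite normrM (ger0_norm h1) ler_piMl.
have Pcvg x : cvgn (P ^~ x).
  have -> : P ^~ x = series (fun m => c m * v m x).
    by apply/funext => M; rewrite /P /series/= big_mkord.
  apply: normed_cvg; apply: nondecreasing_is_cvgn.
    apply/nondecreasing_seqP => n; rewrite /= /series /=.
    by rewrite big_nat_recr//= lerDl.
  exists (Z x) => _ [M _ <-]; rewrite /= /series /=.
  rewrite big_mkord.
  apply: le_trans (vZ M x); apply: ler_sum => m _; have /andP[h1 h2] := c01 m.
  by rewrite normrM (ger0_norm h1) ler_piMl.
pose U x := limn (P ^~ x).
have mU : measurable_fun setT U.
  by apply: (measurable_fun_cvg (h := P)) => [n|x _]; [exact: Linf_meas (LP n)|exact: Pcvg].
have LU : Linf mu U.
  apply: (Linf_le mU LZ); apply: nearW => x; apply: le_trans (ler_norm _).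
  have /cvg_norm/cvgr_to_le := Pcvg x; apply.
  by near=> n; exact: PZ.
have PU k : L1 mu k -> pair_int mu (P M) k @[M --> \oo] --> pair_int mu U k.
  move=> Lk; apply: (pair_int_cvg LP LU LZ Lk); first by apply: nearW => x; exact: Pcvg.
  by apply: nearW => x M; exact: PZ.
have PE M k : L1 mu k -> pair_int mu (P M) k = \sum_(m < M) c m * pair_int mu (v m) k.
  move=> Lk; rewrite pair_int_suml//; last by move=> m; exact: LinfZ.
  by apply: eq_bigr => m _; rewrite pair_intZl.
(* The sum splits into the humps before, at and after [nn j.+1]:
   [3 e / 4 - e / 8 - e / 8 = e / 2]. *)
have Ulow j : e / 2 <= `|pair_int mu U (h (nn j.+1))|.
  have /cvg_norm/cvgr_to_ge := PU _ (Lh (nn j.+1)); apply.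
  near=> M; rewrite PE// -(big_mkord xpredT (fun m => c m * pair_int mu (v m) _)).
  have M2 : (nn j.+2 <= M)%N by near: M; exact: nbhs_infty_ge.
  rewrite (@big_cat_nat _ _ _ (nn j).+1 0 M)//=; last first.
    exact: leq_trans (nnlt j) (leq_trans (ltnW (nnlt _)) M2).
  rewrite (@big_cat_nat _ _ _ (nn j.+2) (nn j).+1 M)//=; last first.
    exact: leq_trans (nnlt j) (ltnW (nnlt _)).
  set b := pair_int mu (v (nn j.+1)) (h (nn j.+1)).
  have -> : \sum_((nn j).+1 <= m < nn j.+2) c m * pair_int mu (v m) (h (nn j.+1)) = b.
    rewrite (@big_cat_nat _ _ _ (nn j.+1) (nn j).+1)//=; last exact: ltnW.
    rewrite big_nat big1 ?add0r; last first.
      move=> m /andP[m1 m2]; rewrite /c; case: asboolP => [[i im]|]; last by rewrite mul0r.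
      have [ij|ji] := leqP i j.
        by move: m1; rewrite -im ltnNge nnmono.
      by move: m2; rewrite -im ltnNge nnmono.
    rewrite big_ltn// big_nat big1 ?addr0; last first.
      move=> m /andP[m1 m2]; rewrite /c; case: asboolP => [[i im]|]; last by rewrite mul0r.
      have [ij|ji] := leqP i j.+1.
        by move: m1; rewrite -im ltnNge nnmono.
      by move: m2; rewrite -im ltnNge nnmono.
    rewrite /c; case: asboolP => [_|[]]; last by exists j.+1.
    by rewrite mul1r.
  have bl : e * 3 / 4 <= `|b| by exact: vh.
  have s1 : `|\sum_(0 <= m < (nn j).+1) c m * pair_int mu (v m) (h (nn j.+1))| <= e / 8.
    apply: le_trans (ler_norm_sum _ _ _) _; rewrite big_mkord.
    apply: (@le_trans _ _ (\sum_(m < (nn j).+1) e / 8 / (nn j).+1%:R)).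
      apply: ler_sum => m _; have /andP[h1 h2] := c01 m.
      rewrite normrM (ger0_norm h1).
      apply: (@le_trans _ _ `|pair_int mu (v m) (h (nn j.+1))|).
        by rewrite ler_piMl.
      by have [_ /(_ m (ltn_ord m))/ltW] := nnP j.
    by rewrite sumr_const card_ord -[X in X <= _]mulr_natr divfK ?pnatr_eq0.
  have s2 : `|\sum_(nn j.+2 <= m < M) c m * pair_int mu (v m) (h (nn j.+1))| < e / 8.
    apply: le_lt_trans (ler_norm_sum _ _ _) _.
    have [_ _ /(_ M)] := nnP j.+1; apply: le_lt_trans.
    apply: ler_sum => m _; have /andP[h1 h2] := c01 m.
    rewrite normrM (ger0_norm h1).
    by apply: (@le_trans _ _ `|pair_int mu (v m) (h (nn j.+1))|); rewrite ?ler_piMl ?le_a.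
  set S1 := \sum_(0 <= m < _) _ in s1 *; set S2 := \sum_(_ <= m < M) _ in s2 *.
  have := lerB_normD b (S1 + S2); have := ler_normD S1 S2.
  by rewrite (_ : b + (S1 + S2) = S1 + (b + S2)); [lra|rewrite addrCA].
(* The functional [U] was not among the tests when [h0] was used, so the subsequence gets its own
   cluster point. Each [v m] pairs to 0 with [h1 - h0], hence so does [U]; yet [U] is at least
   [e / 2] on [h (nn j.+1)] and below [e / 4] on some [g (nn j.+1) - h1]. *)
have [h1 Kh1 h1P] := weak_one_compact_cluster Kc (fun j => Kg (nn j.+1)).
have Lh1 := KL _ Kh1; have Lh10 : L1 mu (fun x => h1 x - h0 x) by exact: L1B.
have split_h n f : Linf mu f -> pair_int mu f (h n) =
    pair_int mu f (fun x => g n x - h1 x) + pair_int mu f (fun x => h1 x - h0 x).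
  move=> Lf; rewrite -pair_intDr//; last exact: L1B.
  by congr pair_int; apply/funext => x; rewrite addrA subrK.
have v0 m : pair_int mu (v m) (fun x => h1 x - h0 x) = 0.
  apply/eqP; rewrite -normr_le0; apply/ler_addgt0Pl => eta eta0; rewrite addr0.
  pose N := Num.truncn (e / 8 / (eta / 2)).
  have eta2 : 0 < eta / 2 by rewrite divr_gt0.
  have [j jN jP] := h1P 1%N (fun=> v m) (eta / 2) (maxn m N) (fun=> Lv m) eta2.
  move: jN; rewrite geq_max => /andP[mj Nj].
  have [_ /(_ m (leq_trans mj (nnj j))) hs _] := nnP j.
  have hs' : `|pair_int mu (v m) (h (nn j.+1))| <= eta / 2.
    apply: le_trans (ltW hs) _; rewrite ler_pdivrMr// [leRHS]mulrC -ler_pdivrMr//.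
    have /andP[_ /ltW] := truncn_itv (ltW (divr_gt0 e8 eta2)).
    by move=> /le_trans; apply; rewrite ler_nat ltnS (leq_trans Nj).
  have := jP ord0; move: hs'; rewrite split_h//.
  set A := pair_int _ _ _; set B := pair_int _ _ _ => hs' hA.
  have -> : B = (A + B) - A by rewrite addrAC subrr add0r.
  by rewrite (le_trans (ler_normB _ _))// [leRHS]splitr lerD// ltW.
have U0 : pair_int mu U (fun x => h1 x - h0 x) = 0.
  apply: (@cvg_unique _ (@Rhausdorff R)
    (pair_int mu (P M) (fun x => h1 x - h0 x) @[M --> \oo])).
    exact: PU.
  rewrite (_ : (fun M => _) = (fun=> 0)); first exact: cvg_cst.
  by apply/funext => M; rewrite PE// big1// => m _; rewrite v0 mulr0.
have e4 : 0 < e / 4 by rewrite divr_gt0.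
have [j _ /(_ ord0)] := h1P 1%N (fun=> U) (e / 4) 0%N (fun=> LU) e4.
have := Ulow j; rewrite split_h// U0 addr0; lra.
Unshelve. all: by end_near. Qed.

End WeakCompact.

(** * Uniformity of order convergence on weakly compact sets *)

Section MackeyOrder.
Context d (T : measurableType d) (R : realType) (mu : {measure set T -> \bar R}).
Implicit Types (f g h w : T -> R) (K : set (T -> R)).

Lemma pair_int_ae_eq f f' g : Linf mu f -> Linf mu f' -> L1 mu g ->
  {ae mu, forall x, f x = f' x} -> pair_int mu f g = pair_int mu f' g.
Proof.
move=> Lf Lf' Lg ff'; apply: ae_eq_Rintegral.
- exact: L1_meas (L1_mul Lf Lg).
- exact: L1_meas (L1_mul Lf' Lg).
- by apply: filterS ff' => x ->.
Qed.

Definition clip (a b : R) : R := Num.max (- b) (Num.min a b).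

Lemma norm_clip_le (a b : R) : 0 <= b -> `|clip a b| <= b.
Proof.
move=> b0; rewrite ler_norml le_max lexx/= ge_max ge_min lexx orbT andbT.
by rewrite (le_trans _ b0)// oppr_le0.
Qed.

Lemma clip_id (a b : R) : `|a| <= b -> clip a b = a.
Proof.
rewrite ler_norml => /andP[h1 h2]; rewrite /clip (min_idPl h2).
exact/max_idPr.
Qed.

Lemma norm_subr_clip (a b c : R) : 0 <= b -> b <= c -> `|a| <= c ->
  `|a - clip a b| <= c - b.
Proof.
move=> b0 bc; rewrite ler_norml => /andP[h1 h2].
have [ab|ba] := leP a b.
  rewrite /clip (min_idPl ab); have [nba|anb] := leP (- b) a.
    by rewrite subrr normr0 subr_ge0.
  by rewrite ler_norml; apply/andP; split; lra.
rewrite /clip (min_idPr (ltW ba)) (max_idPr _); last by lra.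
by rewrite ler_norml; apply/andP; split; lra.
Qed.

Lemma Linf_clip f g : Linf mu f -> Linf mu g -> Linf mu (fun x => clip (f x) (g x)).
Proof. by move=> Lf Lg; apply: Linf_max; [exact: LinfN|exact: Linf_min]. Qed.

(** If uniformity fails, bad pairs of an index and an element of [K] are chosen inductively, each
    index so late that the gap there has integral below [e / 2] against the previous element.
    Removing from each error the part that fits under the next gap leaves the humps [v n], which
    contradict [weak_one_compact_small]. *)
Lemma order_cvg_unif (I : Type) (le : I -> I -> Prop) (x : I -> T -> R) l K (e : R) :
  directed_preorder le -> (forall i, Linf mu (x i)) -> Linf mu l ->
  order_cvg mu le x l -> weak_one_compact mu K -> 0 < e ->
  exists i, forall j, le i j -> forall g, K g ->
    `|pair_int mu (fun t => x j t - l t) g| <= e.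
Proof.
move=> dI Lx Ll /(order_cvg_dominated dI)[D [LD D0 Dmono [i0 i0P] Dint]] Kc e0.
have [_ lerefl letr ledir] := dI; have KL := Kc.1; apply: contrapT => ni.
have {}ni i : exists j, le i j /\ exists g, K g /\
    e < `|pair_int mu (fun t => x j t - l t) g|.
  apply: contrapT => nj; apply: ni; exists i => j ij g Kg.
  by rewrite leNgt; apply/negP => h; apply: nj; exists j; split=> //; exists g.
have e2 : 0 < e / 2 by rewrite divr_gt0.
pose good (p : I * (T -> R)) := [/\ le i0 p.1, K p.2 &
  e < `|pair_int mu (fun t => x p.1 t - l t) p.2|].
pose rel (p q : {p | good p}) := le (sval p).1 (sval q).1 /\
  pair_int mu (D (sval q).1) (fun t => `|(sval p).2 t|) < e / 2.
have relP p : {q | rel p q}.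
  apply: cid; case: p => -[i g] /= [i0i Kg ig].
  have [k kP] := Dint _ (L1_norm (KL _ Kg)) (fun t => normr_ge0 _) _ e2.
  have [k' [k1 k2]] := ledir i k; have [j [kj [g' [Kg' jg]]]] := ni k'.
  have ij : le i j by exact: letr kj.
  have gd : good (j, g') by split=> //=; exact: letr ij.
  by exists (exist _ (j, g') gd); split=> //=; apply: kP; exact: letr kj.
have [p0 _] : exists p : {p | good p}, True.
  have [j [ij [g [Kg jg]]]] := ni i0.
  have gd : good (j, g) by split.
  by exists (exist _ (j, g) gd).
have [s [_ sP]] := dependent_choice relP p0.
pose j n := (sval (s n)).1; pose g n := (sval (s n)).2.
have jP n : good (j n, g n) by rewrite /j /g; case: (s n) => -[].
have Kg n : K (g n) by have [] := jP n.
have Lg n : L1 mu (g n) by exact: KL.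
(* The gaps [D] are nonnegative and decreasing only almost everywhere; [Z] is a version with both
   properties at every point, as the pointwise bound on the sums of [|v n|] requires. *)
pose Z := fix Z n t := match n with
  | 0%N => `|D (j 0%N) t| | m.+1 => Num.min (Z m t) `|D (j m.+1) t| end.
have LZ n : Linf mu (Z n).
  elim: n => [|n IH]; first exact: Linf_norm.
  by apply: Linf_min => //; exact: Linf_norm.
have Z0 n t : 0 <= Z n t by elim: n => [|n IH] //=; rewrite le_min IH /=.
have Zd n t : Z n.+1 t <= Z n t by rewrite /= ge_min lexx.
have ZD n : {ae mu, forall t, Z n t = D (j n) t}.
  elim: n => [|n IH]; first by apply: filterS (D0 (j 0%N)) => t h; exact: ger0_norm.
  have jj : le (j n) (j n.+1) by have [] := sP n.
  apply: filterS3 IH (Dmono _ _ jj) (D0 (j n.+1)) => t h1 h2 h3 /=.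
  by rewrite h1 (ger0_norm h3); exact/min_idPr.
pose X n t := clip (x (j n) t - l t) (Z n t).
have LX n : Linf mu (X n) by apply: Linf_clip => //; exact: LinfB.
have XZ n t : `|X n t| <= Z n t by exact: norm_clip_le.
have XE n : {ae mu, forall t, X n t = x (j n) t - l t}.
  have [i0j _ _] := jP n.
  by apply: filterS2 (ZD n) (i0P _ i0j) => t h1 h2; rewrite /X clip_id// h1.
(* Truncating at the next level makes [|v n|] telescope and changes the pairing with
   [g n] by at most [e / 2]. *)
pose v n t := X n t - clip (X n t) (Z n.+1 t).
have Lc n : Linf mu (fun t => clip (X n t) (Z n.+1 t)) by exact: Linf_clip.
have Lv n : Linf mu (v n) by exact: LinfB.
have vZ N t : \sum_(m < N) `|v m t| <= Z 0%N t.
  suff : \sum_(m < N) `|v m t| <= Z 0%N t - Z N t.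
    by move=> /le_trans; apply; rewrite gerBl.
  elim: N => [|N IH]; first by rewrite big_ord0 subrr.
  have S : \sum_(m < N.+1) `|v m t| = \sum_(m < N) `|v m t| + `|v N t|.
    by rewrite big_ord_recr.
  have H : `|v N t| <= Z N t - Z N.+1 t by exact: norm_subr_clip.
  by rewrite S (le_trans (lerD IH H))// addrA subrK.
have [n nv] := weak_one_compact_small Kc Lv (LZ 0%N) vZ Kg e2.
have [_ _ /= ne] := jP n; move: nv; apply/negP; rewrite -leNgt.
rewrite /v pair_intBl// (pair_int_ae_eq (LX n) (LinfB (Lx _) Ll) (Lg n) (XE n)).
have cs : `|pair_int mu (fun t => clip (X n t) (Z n.+1 t)) (g n)| <= e / 2.
  apply: le_trans (norm_pair_int (Lc n) (Lg n)) _.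
  have [_ /ltW] := sP n; apply: le_trans; apply: le_pair_int => //.
  - exact: Linf_norm.
  - exact: L1_norm.
  - by apply: filterS (ZD n.+1) => t <-; exact: norm_clip_le.
apply: le_trans (lerB_dist _ _); lra.
Qed.

Lemma mackey_tau_O : mackey mu `<=` tau_O mu.
Proof.
move=> U [UL Uo]; split=> //; split=> [f []//|I le x l dI Fx Ll xl].
split=> // Ul; have [n [rho [e [e0 Nrho UU]]]] := Uo _ Ul.
have Lx i : Linf mu (x i) by have [] := Fx i.
have e2 : 0 < e / 2 by rewrite divr_gt0.
have [_ lerefl letr ledir] := dI.
have rhoP k : (k < n)%N -> exists i, forall j, le i j ->
    (rho k (fun t => (x j t - l t)%R) < e%:E)%E.
  move=> kn; have [K [Kc _ ->]] := Nrho _ kn.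
  have [i iP] := order_cvg_unif dI Lx Ll xl Kc e2; exists i => j ij.
  apply: (@le_lt_trans _ _ (e / 2)%:E).
    apply: ge_ereal_sup => _ [g Kg <-]; rewrite pairingE; last exact: Kc.1.
      by rewrite /= lee_fin; exact: iP.
    exact: LinfB.
  by rewrite lte_fin; lra.
have [i iP] : exists i, forall j, le i j -> forall k, (k < n)%N ->
    (rho k (fun t => (x j t - l t)%R) < e%:E)%E.
  clear UU Nrho; elim: n rhoP => [|n IH] rhoP.
    by have [[i] _ _ _] := dI; exists i.
  have [|i iP] := IH; first by move=> k kn; apply: rhoP; exact: ltnW.
  have [i' i'P] := rhoP n (ltnSn n); have [k [k1 k2]] := ledir i i'.
  exists k => j kj m; rewrite ltnS leq_eqVlt => /predU1P[->|mn].
    by apply: i'P; exact: letr kj.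
  by apply: iP => //; exact: letr kj.
by have [_] := Fx i; apply; apply: UU => // k kn; apply: iP.
Qed.

End MackeyOrder.

(** * Atoms, disjoint sequences and strictness *)

Section Atoms.
Context d (T : measurableType d) (R : realType) (mu : {measure set T -> \bar R}).
Implicit Types (f g h w : T -> R) (A B C D : set T).

Definition atom B : Prop := [/\ measurable B, (0 < mu B)%E, (mu B < +oo)%E &
  forall C, measurable C -> C `<=` B -> mu C = 0%E \/ mu (B `\` C) = 0%E].

(** The atoms have to cover [D] up to a null set but not to lie in it, so the notion passes to
    measurable subsets with the same atoms; [n = 0] gives the null sets. *)
Definition finitely_atomic D : Prop := exists (n : nat) (B : nat -> set T),
  (forall i, (i < n)%N -> atom (B i)) /\ mu (D `\` \bigcup_(i in `I_n) B i) = 0%E.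

Definition infinite_disjoint (A : nat -> set T) : Prop :=
  [/\ trivIset setT A, forall n, measurable (A n) &
      forall n, (0 < mu (A n))%E /\ (mu (A n) < +oo)%E].

Lemma measure_sub0 A B : measurable A -> measurable B -> A `<=` B ->
  mu B = 0%E -> mu A = 0%E.
Proof.
move=> mA mB AB B0; apply/eqP; rewrite eq_le measure_ge0 andbT -B0.
by apply: le_measure => //; rewrite inE.
Qed.

Lemma measurable_atoms n (B : nat -> set T) : (forall i, (i < n)%N -> atom (B i)) ->
  measurable (\bigcup_(i in `I_n) B i).
Proof. by move=> Ba; apply: bigcup_measurable => i /Ba[]. Qed.

Lemma finitely_atomicS D D' : measurable D -> measurable D' -> D' `<=` D ->
  finitely_atomic D -> finitely_atomic D'.
Proof.
move=> mD mD' DD [n [B [Ba B0]]]; exists n, B; split=> //.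
have mB := measurable_atoms Ba.
apply: measure_sub0 B0; [exact: measurableD|exact: measurableD|].
exact: setSD.
Qed.

Lemma finitely_atomicU D D' : measurable D -> measurable D' ->
  finitely_atomic D -> finitely_atomic D' -> finitely_atomic (D `|` D').
Proof.
move=> mD mD' [n [B [Ba B0]]] [m [B' [Ba' B0']]].
have mB := measurable_atoms Ba; have mB' := measurable_atoms Ba'.
pose E i := if (i < n)%N then B i else B' (i - n)%N.
have Ea i : (i < n + m)%N -> atom (E i).
  move=> ilt; rewrite /E; case: (ltnP i n) => h; first exact: Ba.
  by apply: Ba'; rewrite ltn_subLR.
exists (n + m)%N, E; split=> //.
have mE := measurable_atoms Ea.
apply: (@measure_sub0 _ ((D `\` \bigcup_(i in `I_n) B i) `|`
    (D' `\` \bigcup_(i in `I_m) B' i))).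
- by apply: measurableD => //; exact: measurableU.
- by apply: measurableU; exact: measurableD.
- move=> x [[Dx|Dx] nE]; [left|right]; split=> // -[i /= ilt Bi]; apply: nE.
    by exists i; [exact: ltn_addr|rewrite /E ilt].
  exists (n + i)%N; first by rewrite /= ltn_add2l.
  by rewrite /E ltnNge leq_addr/= addKn.
apply/eqP; rewrite eq_le measure_ge0 andbT.
apply: le_trans (measureU2 _ (measurableD mD mB) (measurableD mD' mB')) _.
by rewrite [X in (X + _)%E]B0 [X in (_ + X)%E]B0' adde0.
Qed.

Lemma atom_finitely_atomic B : atom B -> finitely_atomic B.
Proof.
move=> Ba; exists 1%N, (fun=> B); split=> //.
rewrite (_ : _ `\` _ = set0) ?measure0//; apply/seteqP; split=> // x [Bx nB].
by apply: nB; exists 0%N.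
Qed.

Lemma null_finitely_atomic D : mu D = 0%E -> finitely_atomic D.
Proof.
move=> D0; exists 0%N, (fun=> set0); split=> //.
rewrite (_ : _ `\` _ = D)//; apply/seteqP; split=> [x []//|x Dx].
by split=> // -[].
Qed.

Hypothesis sf : semi_finite mu.

Lemma semi_finite_sub D : measurable D -> (0 < mu D)%E ->
  exists C, [/\ measurable C, C `<=` D, (0 < mu C)%E & (mu C < +oo)%E].
Proof.
move=> mD D0; have [Doo|Doo] := eqVneq (mu D) +oo%E.
  by have [B [? ? ? ?]] := sf mD Doo; exists B.
by exists D; split=> //; rewrite ltey.
Qed.

(** Start from any [C] in [D] of finite positive measure. If removing it leaves something finitely
    atomic, then [C] is not finitely atomic, so it is no atom and splits into two nonnull pieces;
    one of them is not finitely atomic, and the other one is removed. *)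
Lemma not_finitely_atomic_split D : measurable D -> ~ finitely_atomic D ->
  exists C, [/\ measurable C, C `<=` D, (0 < mu C)%E, (mu C < +oo)%E &
    ~ finitely_atomic (D `\` C)].
Proof.
move=> mD nD.
have D0 : (0 < mu D)%E.
  by rewrite lt0e measure_ge0 andbT; apply/eqP => /null_finitely_atomic.
have [C [mC CD C0 Coo]] := semi_finite_sub mD D0.
have [fDC|] := pselect (finitely_atomic (D `\` C)); last by exists C.
have nC : ~ finitely_atomic C.
  move=> fC; apply: nD; rewrite -(setDUK CD).
  by apply: finitely_atomicU => //; exact: measurableD.
have [E [mE EC E0 CE0]] : exists E, [/\ measurable E, E `<=` C, mu E != 0%E &
    mu (C `\` E) != 0%E].
  apply: contrapT => nE; apply: nC; apply: atom_finitely_atomic; split=> // E mE EC.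
  have [E0|E0] := eqVneq (mu E) 0%E; first by left.
  have [CE0|CE0] := eqVneq (mu (C `\` E)) 0%E; first by right.
  by exfalso; apply: nE; exists E.
have mCE : measurable (C `\` E) by exact: measurableD.
have [F [mF FC F0 nF]] : exists F, [/\ measurable F, F `<=` C, mu F != 0%E &
    ~ finitely_atomic (C `\` F)].
  have [fE|nE] := pselect (finitely_atomic E).
    exists E; split=> // fCE; apply: nC; rewrite -(setDUK EC).
    exact: finitely_atomicU.
  exists (C `\` E); split=> //.
  by rewrite setDD (setIidr EC).
exists F; split=> //; first exact: subset_trans CD.
- by rewrite lt0e F0 measure_ge0.
- by apply: le_lt_trans Coo; apply: le_measure => //; rewrite inE.
- move=> fDF; apply: nF; apply: finitely_atomicS fDF; try exact: measurableD.
  exact: setSD.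
Qed.

(** Pieces are split off one after the other, always leaving a remainder that is not finitely
    atomic; the disjoint sets are the successive differences. *)
Lemma infinite_disjoint_ex : ~ finitely_atomic setT -> exists A : nat -> set T, infinite_disjoint A.
Proof.
move=> nT; pose X := {D | measurable D /\ ~ finitely_atomic D}.
pose rel (D D' : X) := [/\ sval D' `<=` sval D, (0 < mu (sval D `\` sval D'))%E &
  (mu (sval D `\` sval D') < +oo)%E].
have relP (D : X) : {D' | rel D D'}.
  apply: cid; case: D => D [mD nD].
  have [C [mC CD C0 Coo nC]] := not_finitely_atomic_split mD nD.
  exists (exist _ (D `\` C) (conj (measurableD mD mC) nC)).
  by split=> /=; [exact: subDsetl|rewrite setDD (setIidr CD)..].
have [s [_ sP]] := dependent_choice relP (exist _ setT (conj measurableT nT)).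
have mono m n : (m <= n)%N -> sval (s n) `<=` sval (s m).
  move=> /subnK <-; elim: (n - m)%N => // k IH; rewrite addSn.
  by apply: subset_trans IH; have [] := sP (k + m)%N.
have ms n : measurable (sval (s n)) by case: (s n) => D [].
exists (fun n => sval (s n) `\` sval (s n.+1)); split.
- move=> i j _ _ [x [[xi nxi] [xj nxj]]]; have [ij|ji|//] := ltngtP i j; exfalso.
    by apply: nxi; exact: mono ij _ xj.
  by apply: nxj; exact: mono ji _ xi.
- by move=> n; exact: measurableD.
- by move=> n; have [] := sP n.
Qed.

Lemma pair_int_cst_indic (c : R) B : measurable B -> (mu B < +oo)%E ->
  pair_int mu (fun=> c) \1_B = c * fine (mu B).
Proof.
move=> mB Boo; rewrite /pair_int RintegralZl//; last exact: L1_indic.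
by rewrite /Rintegral integral_indic// setIT.
Qed.

(** The constant is the mean of [f] over [B]. As [f <= c] holds on a null or a conull part of the
    atom, [f - c] has one sign there, and its integral over [B] is 0. *)
Lemma atom_ae_cst B f : atom B -> Linf mu f ->
  exists c, {ae mu, forall x, B x -> f x = c}.
Proof.
move=> [mB B0 Boo Bat] Lf; pose c := pair_int mu f \1_B / fine (mu B); exists c.
have L1B : L1 mu \1_B by exact: L1_indic.
have Lc : Linf mu (fun x => f x - c) by apply: LinfB => //; exact: Linf_cst.
have fB0 : fine (mu B) != 0.
  by rewrite gt_eqF// fine_gt0// B0.
have g0 : pair_int mu (fun x => f x - c) \1_B = 0.
  rewrite pair_intBl//; last exact: Linf_cst.
  by rewrite pair_int_cst_indic// /c divfK// subrr.
pose C := B `&` [set x | f x <= c].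
have mC : measurable C by apply: measurable_fun_le => //; apply: measurable_funTS; exact: Linf_meas Lf.
have L0 h : Linf mu h -> (h = (fun x => f x - c) \/ h = (fun x => - (f x - c))) ->
    {ae mu, forall x, B x -> 0 <= h x} -> {ae mu, forall x, B x -> f x = c}.
  move=> Lh hE hB.
  have hmB : pair_int mu h \1_B = 0.
    case: hE => ->//; rewrite (_ : (fun x => _) = (fun x => -1 * (f x - c))).
      by rewrite (pair_intZl _ Lc L1B) g0 mulr0.
    by apply/funext => x; rewrite mulN1r.
  have : pair_int mu (fun x => `|h x|) \1_B = 0.
    rewrite -hmB; apply: ae_eq_Rintegral.
    - by have := L1_meas (L1_mul (Linf_norm Lh) L1B).
    - by have := L1_meas (L1_mul Lh L1B).
    apply: filterS hB => x hB; rewrite indicE; case: (boolP (x \in B)) => xB; last by rewrite !mulr0.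
    by rewrite ger0_norm//; apply: hB; rewrite inE in xB.
  move=> /(pair_int_eq0 (Linf_norm Lh) L1B (fun x => normr_ge0 _)) h0.
  have : {ae mu, forall x, `|h x| * \1_B x = 0} by exact: h0.
  apply: filterS => x + Bx; rewrite indicE mem_set// mulr1 => /eqP.
  rewrite normr_eq0 => /eqP; case: hE => ->; first by move/eqP; rewrite subr_eq0 => /eqP.
  by move/eqP; rewrite oppr_eq0 subr_eq0 => /eqP.
have [C0|C0] := Bat C mC (@subIsetl _ _ _).
  apply: (L0 _ Lc); first by left.
  exists C; split=> // x /= nx; split; first by apply: contrapT => nB; apply: nx.
  by rewrite /= leNgt; apply/negP => cf; apply: nx => _; rewrite subr_ge0 ltW.
apply: (L0 (fun x => - (f x - c))); [exact: LinfN|by right|].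
exists (B `\` C); split=> //; first exact: measurableD.
move=> x /= nx; split; first by apply: contrapT => nB; apply: nx.
by move=> -[Bx fx]; apply: nx => _; rewrite oppr_ge0 subr_le0.
Qed.

Lemma finitely_atomic_findim : finitely_atomic setT -> Linf_findim mu.
Proof.
(* The given atoms may overlap or coincide; [seqDU] makes them disjoint, so that exactly one
   coefficient counts at each covered point. *)
move=> [n [B [Ba B0]]]; exists n, (fun i : 'I_n => \1_(seqDU B i)).
have mB i : (i < n)%N -> measurable (B i) by move=> /Ba[].
have mD (i : 'I_n) : measurable (seqDU B i).
  apply: measurableD; first exact: mB.
  by apply: bigsetU_measurable => k _; apply: mB; exact: ltn_trans (ltn_ord i).
split=> [i|f Lf]; first exact: Linf_indic.
have /choice[c cP] : forall i : 'I_n, exists c, {ae mu, forall x, B i x -> f x = c}.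
  by move=> i; apply: atom_ae_cst => //; exact: Ba.
exists c; have cP' : {ae mu, forall x, forall i : 'I_n, B i x -> f x = c i}.
  exact: filter_forall.
have cov : {ae mu, forall x, (\bigcup_(i in `I_n) B i) x}.
  exists (setT `\` \bigcup_(i in `I_n) B i); split=> //.
  by apply: measurableD => //; exact: measurable_atoms.
apply: filterS2 cP' cov => x fx; rewrite bigcup_mkord bigsetU_seqDU -bigcup_mkord.
move=> [i /= ilt Dx]; pose o := Ordinal ilt.
rewrite (bigD1 o)//= big1 ?addr0; last first.
  move=> j jo; rewrite indicE memNset ?mulr0// => Dj; case/negP: jo; apply/eqP/val_inj.
  by apply: (@trivIset_seqDU _ B j i I I); exists x.
by rewrite indicE mem_set// mulr1; apply: fx; case: Dx.
Qed.

(** If [|h| > e] on a nonnull part of an atom, then on almost all of it, so the integral of [|h|]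
    over the atoms is at least [e] times the smallest mass [m] of an atom. *)
Lemma finitely_atomic_tau_inf : finitely_atomic setT -> tau_inf mu `<=` sigma_p mu 1.
Proof.
move=> [n [B [Ba B0]]] U /tau_infP[UL Uo]; apply: gauge_openS => // f Uf.
have [e e0 eP] := Uo _ Uf.
have L1B (i : 'I_n) : L1 mu \1_(B i) by have [? ? ? ?] := Ba i (ltn_ord i); exact: L1_indic.
pose w x := \sum_(i < n) (\1_(B i) x : R).
have Lw : L1 mu w by exact: (L1_sum _ L1B).
have w0 x : 0 <= w x by exact: sumr_ge0.
exists (fun h => 'N[mu]_(1%:E)[(fun x => (h x * w x)%R%:E)])%E; split.
  exists w; split=> //; split; first exact: L1_meas Lw.
  by rewrite Lnorm1; have /integrableP[] := Lw.
have muB (i : 'I_n) : 0 < fine (mu (B i)).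
  by have [? B0' Boo ?] := Ba i (ltn_ord i); rewrite fine_gt0// B0'.
pose m := \big[Num.min/1]_(i < n) fine (mu (B i)).
have m0 : 0 < m by rewrite /m; elim/big_ind: _ => // x y x0 y0; rewrite lt_min x0.
exists (e * m); first exact: mulr_gt0.
move=> g Lg gm; apply: eP => //; pose h x := g x - f x.
have Lh : Linf mu h by apply: LinfB => //; exact: UL.
have hm : pair_int mu (fun x => `|h x|) w < e * m.
  move: gm; rewrite Lnorm1 -lte_fin -pairingE//; last exact: Linf_norm.
  apply: le_lt_trans; rewrite /pairing le_eqVlt; apply/orP; left; apply/eqP.
  by apply: eq_integral => x _ /=; rewrite normrM (ger0_norm (w0 x)).
pose D := [set x | e < `|h x|].
have mD : measurable D.
  have -> : D = ~` [set x | `|h x| <= e].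
    by apply/seteqP; split=> x; rewrite /D /= ltNge => /negP.
  apply: measurableC; rewrite -[X in measurable X]setTI; apply: measurable_fun_le => //.
  exact: Linf_meas (Linf_norm Lh).
suff D0 : mu D = 0%E.
  by exists D; split=> // x /= /negP; rewrite -ltNge.
have mBi i : (i < n)%N -> measurable (B i) by move=> /Ba[].
have DB i : (i < n)%N -> mu (D `&` B i) = 0%E.
  move=> ilt; have [mB B0' Boo Bat] := Ba i ilt; pose o := Ordinal ilt.
  have [||//|BD0] := Bat (D `&` B i); [exact: measurableI|exact: subIsetr|].
  exfalso; move: hm; apply/negP; rewrite -leNgt.
  apply: (@le_trans _ _ (e * fine (mu (B i)))).
    by rewrite ler_wpM2l ?(ltW e0)//; exact: (bigmin_le _ o).
  rewrite -pair_int_cst_indic//; apply: ae_le_Rintegral.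
  - by apply: L1_mul; [exact: Linf_cst|exact: L1_indic].
  - by apply: L1_mul => //; exact: Linf_norm.
  exists (B i `\` (D `&` B i)); split=> //.
    by apply: measurableD => //; exact: measurableI.
  move=> x /= nx; have Bx : B i x.
    apply: contrapT => nB; apply: nx; rewrite indicE memNset// mulr0.
    exact: mulr_ge0.
  split=> // -[Dx _]; apply: nx; rewrite indicE mem_set// mulr1.
  have w1 : 1 <= w x.
    rewrite /w (bigD1 o)//= indicE mem_set// lerDl.
    by apply: sumr_ge0 => j _.
  by rewrite (le_trans (ltW Dx))// ler_peMr.
have DU : D `<=` (setT `\` \bigcup_(i in `I_n) B i) `|` \big[setU/set0]_(i < n) (D `&` B i).
  move=> x Dx; have [[i /= ilt Bx]|nB] := pselect ((\bigcup_(i in `I_n) B i) x); last by left.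
  by right; rewrite -(bigcup_mkord n (fun i => D `&` B i)); exists i.
have mU : measurable (setT `\` \bigcup_(i in `I_n) B i).
  by apply: measurableD => //; exact: measurable_atoms.
have mV : measurable (\big[setU/set0]_(i < n) (D `&` B i)).
  by apply: bigsetU_measurable => i _; apply: measurableI => //; exact: mBi.
apply: measure_sub0 DU _ => //; first exact: measurableU.
apply/eqP; rewrite eq_le measure_ge0 andbT; apply: le_trans (measureU2 _ mU mV) _.
rewrite [X in (X + _)%E]B0 add0e.
apply: le_trans (Boole_inequality _ (fun i ilt => measurableI _ _ mD (mBi i ilt))) _.
by rewrite big1// => i _; exact: DB.
Qed.

End Atoms.

(** * Summable weights of harmonic type *)

Section Weights.
Context (R : realType).

(** A discrete mean value estimate with [x = n + 1] and [y = n + 2]: from [ln (x / y) <= - 1 / y]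
    and [exp u >= 1 + u] one gets [(x / y)^(- th) >= 1 + th / y]. *)
Lemma powR_decrement (th : R) (n : nat) : 0 < th ->
  th * n.+2%:R `^ (- (th + 1)) <= n.+1%:R `^ (- th) - n.+2%:R `^ (- th).
Proof.
move=> th0; set x : R := n.+1%:R; set y : R := n.+2%:R.
have x0 : 0 < x by rewrite ltr0n.
have y0 : 0 < y by rewrite ltr0n.
have yx : y - x = 1 by rewrite /y /x -natrB// subSnn.
have lnxy : ln (x / y) <= - y^-1.
  have xy : 0 < x / y by rewrite divr_gt0.
  have := @le_ln1Dx R (x / y - 1); rewrite addrCA subrr addr0 => h.
  apply: le_trans (h _) _; first by rewrite ltrBrDl subrr.
  have -> : x / y - 1 = (x - y) / y by rewrite mulrBl divff// gt_eqF.
  by rewrite -opprB yx mulN1r.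
have key : 1 + th * y^-1 <= (x / y) `^ (- th).
  have xy : x / y != 0 by rewrite gt_eqF// divr_gt0.
  rewrite /powR (negbTE xy); apply: le_trans (expR_ge1Dx _).
  by rewrite lerD2l mulNr -mulrN ler_wpM2l ?(ltW th0)// lerNr.
have E : x `^ (- th) = (x / y) `^ (- th) * y `^ (- th).
  by rewrite -powRM ?divfK ?gt_eqF// ?divr_ge0 ?ltW.
have F : y `^ (- (th + 1)) = y `^ (- th) * y^-1.
  rewrite opprD powRD; first by rewrite powR_inv1// ltW.
  by apply/implyP => _; rewrite gt_eqF.
rewrite E F; apply: (@le_trans _ _ ((1 + th * y^-1) * y `^ (- th) - y `^ (- th))).
  by rewrite mulrDl mul1r addrAC subrr add0r -mulrA (mulrC y^-1).
by rewrite lerB// ler_wpM2r ?powR_ge0.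
Qed.

(* a_n = (n+1)^-theta - (n+2)^-theta with theta = q/p - 1: the sum telescopes,
   while a_n^(p/q) is at least a multiple of the harmonic sequence. *)
Lemma summable_weight (p q : R) : 0 < p -> p < q -> exists a : nat -> R,
  [/\ forall n, 0 < a n, forall N, \sum_(n < N) a n <= 1 &
    exists2 k : R, 0 < k & forall n, k / n.+2%:R <= a n `^ (p / q)].
Proof.
move=> p0 pq; have q0 : 0 < q by exact: lt_trans pq.
pose th := q / p - 1; have th0 : 0 < th by rewrite subr_gt0 ltr_pdivlMr// mul1r.
pose c (n : nat) : R := n.+1%:R `^ (- th).
have ca n : th * n.+2%:R `^ (- (th + 1)) <= c n - c n.+1 by exact: powR_decrement.
have b0 n : 0 < th * n.+2%:R `^ (- (th + 1)) by rewrite mulr_gt0// powR_gt0.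
exists (fun n => c n - c n.+1); split.
- by move=> n; exact: lt_le_trans (ca n).
- move=> N; have -> : \sum_(n < N) (c n - c n.+1) = c 0%N - c N.
    elim: N => [|N IH]; first by rewrite big_ord0 subrr.
    by rewrite big_ord_recr/= IH addrA subrK.
  by rewrite lerBlDr /c powR1 lerDl powR_ge0.
exists (th `^ (p / q)); first exact: powR_gt0.
move=> n; have pq0 : 0 <= p / q by rewrite divr_ge0// ltW.
apply: (@le_trans _ _ ((th * n.+2%:R `^ (- (th + 1))) `^ (p / q))); last first.
  rewrite ge0_ler_powR ?nnegrE ?(ltW (b0 n))//.
  by rewrite ltW// (lt_le_trans (b0 n)).
rewrite powRM ?(ltW th0) ?powR_ge0// -powRrM.
have -> : - (th + 1) * (p / q) = -1.
  by rewrite /th subrK mulNr mulrA divfK ?divff ?gt_eqF.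
by rewrite powR_inv1.
Qed.

Lemma sum_indic_le1 (T : Type) (A : (set T)^nat) N x : trivIset setT A ->
  \sum_(n < N) (\1_(A n) x : R) <= 1.
Proof.
move=> tA; have /andP[+ _] := @sum_indic_trivIset T R A N x tA.
rewrite subr_ge0 => /le_trans; apply.
by rewrite indicE; case: (_ \in _).
Qed.

End Weights.

(** * Disjoint sets separating the topologies *)

Section Strictness.
Context d (T : measurableType d) (R : realType) (mu : {measure set T -> \bar R}).
Implicit Types (f g h w : T -> R) (A : nat -> set T).

(** Disjointness bounds the sum of the masses by the integral of [w], while masses of at least
    [e / (n + 2)] throughout would have a divergent sum. *)
Lemma small_mass A w (e : R) : infinite_disjoint mu A -> L1 mu w ->
  (forall x, 0 <= w x) -> 0 < e ->
  exists n, pair_int mu \1_(A n) w < e / n.+2%:R.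
Proof.
move=> [tA mA _] Lw w0 e0; apply: contrapT => nn.
have {}nn n : e / n.+2%:R <= pair_int mu \1_(A n) w.
  by rewrite leNgt; apply/negP => h; apply: nn; exists n.
pose S := pair_int mu (fun=> 1) w.
have LA n : Linf mu \1_(A n) by exact: Linf_indic.
have sumS N : \sum_(n < N) e / n.+2%:R <= S.
  apply: (@le_trans _ _ (\sum_(n < N) pair_int mu \1_(A n) w)).
    by apply: ler_sum => n _; exact: nn.
  rewrite -pair_int_suml//; apply: le_pair_int => //.
  - exact: Linf_sum.
  - exact: Linf_cst.
  - by apply: nearW => x; exact: sum_indic_le1.
apply: (@dvg_harmonic R); apply: nondecreasing_is_cvgn.
  by apply/nondecreasing_seqP => n; rewrite /series/= big_nat_recr//= lerDl.
(* The harmonic series starts at 1 but the masses start at [e / 2]; its first term is bounded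
   separately. *)
exists (1 + S / e) => _ [N _ <-]; rewrite /series/= big_mkord.
apply: (@le_trans _ _ (\sum_(n < N.+1) n.+1%:R^-1)).
  by rewrite big_ord_recr/= lerDl.
rewrite big_ord_recl/= invr1 lerD2l ler_pdivlMr// mulr_suml.
by apply: le_trans (sumS N); apply: ler_sum => n _; rewrite mulrC.
Qed.

(** The weight is the sum of the indicators of [A n] times [a n / mu (A n)]; at each point at most
    one term is nonzero, and termwise integration bounds the total by 1. *)
Lemma weight_ex A (a : nat -> R) : infinite_disjoint mu A -> (forall n, 0 < a n) ->
  (forall N, \sum_(n < N) a n <= 1) ->
  exists w, [/\ L1 mu w, forall x, 0 <= w x &
    forall n, pair_int mu \1_(A n) w = a n].
Proof.
move=> [tA mA A0] a0 a1.
have m0 n : 0 < fine (mu (A n)) by have [h1 h2] := A0 n; rewrite fine_gt0// h1.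
pose b n := a n / fine (mu (A n)).
have b0 n : 0 < b n by exact: divr_gt0.
pose f n x := (b n * \1_(A n) x)%:E.
have f0 n x : (0 <= f n x)%E by rewrite lee_fin mulr_ge0// ltW.
have mf n : measurable_fun setT (f n).
  by apply/measurable_EFinP; apply: measurable_funM => //; exact: measurable_indic.
pose F x := (\sum_(n <oo) f n x)%E.
have Fi i x : A i x -> F x = (b i)%:E.
  move=> Ax; apply: cvg_lim => //; apply: cvg_near_cst; near=> N.
  have iN : (i < N)%N by near: N; exact: nbhs_infty_gt.
  rewrite big_mkord (bigD1 (Ordinal iN))//= big1 ?adde0.
    by rewrite /f indicE mem_set// mulr1.
  move=> j ji; rewrite /f indicE memNset ?mulr0// => Aj.
  by case/negP: ji; apply/eqP/val_inj; apply: (tA _ _ I I); exists x.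
have Fn x : ~ (\bigcup_i A i) x -> F x = 0%E.
  move=> nA; rewrite /F eseries0// => n _ _; rewrite /f indicE memNset ?mulr0//.
  by move=> Ax; apply: nA; exists n.
have Ffin x : F x \is a fin_num.
  by have [[i _ /Fi->]//|/Fn->] := pselect ((\bigcup_i A i) x).
have F0 x : (0 <= F x)%E by exact: nneseries_ge0.
pose w x := fine (F x).
have wE : EFin \o w = F by apply/funext => x; rewrite /w /= fineK.
have w0 x : 0 <= w x by exact: fine_ge0.
have mF : measurable_fun setT F by exact: ge0_emeasurable_sum.
have int_f n : (\int[mu]_x f n x)%E = (a n)%:E.
  under eq_integral do rewrite /f EFinM.
  rewrite ge0_integralZl_EFin//; [|exact/measurable_EFinP/measurable_indic|exact: ltW].
  rewrite integral_indic// setIT -(fineK (_ : mu (A n) \is a fin_num)).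
    by rewrite -EFinM /b divfK// gt_eqF.
  by have [_ Aoo] := A0 n; rewrite ge0_fin_numE.
have Lw : L1 mu w.
  rewrite /L1/= wE; apply/integrableP; split=> //.
  under eq_integral do rewrite gee0_abs//.
  rewrite /F integral_nneseries//; under eq_eseriesr do rewrite int_f.
  apply: (@le_lt_trans _ _ 1%:E); last by rewrite ltry.
  apply: lime_le.
    by apply: is_cvg_nneseries => n _ _; rewrite lee_fin ltW.
  by near=> N; rewrite sumEFin big_mkord lee_fin.
exists w; split=> // n; apply: EFin_inj.
rewrite -pairingE//; last exact: Linf_indic.
rewrite -int_f; apply: eq_integral => x _; rewrite /f indicE.
case: (boolP (x \in A n)) => xA; last by rewrite mul0r mulr0.
by rewrite mul1r mulr1 -[LHS]/((EFin \o w) x) wE (Fi n)//; rewrite inE in xA.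
Unshelve. all: by end_near. Qed.

Lemma pow_int_indic p (t : R) (B : set T) w : 0 < p -> 0 <= t -> measurable B ->
  L1 mu w -> pow_int mu p (fun x => t * \1_B x) w = t `^ p * pair_int mu \1_B w.
Proof.
move=> p0 t0 mB Lw; rewrite -pair_intZl//; last exact: Linf_indic.
congr pair_int; apply/funext => x; rewrite ger0_norm ?mulr_ge0//.
rewrite indicE; case: (x \in B); first by rewrite !mulr1.
by rewrite !mulr0 powR0// gt_eqF.
Qed.

Lemma pow_int0 p w : 0 < p -> pow_int mu p (fun=> 0) w = 0.
Proof.
move=> p0; rewrite /pow_int /pair_int.
under eq_Rintegral do rewrite normr0 powR0 ?gt_eqF// mul0r.
by rewrite Rintegral_cst// mul0r.
Qed.

Lemma left_kernel (m n : nat) (M : 'M[R]_(m, n)) : (n < m)%N ->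
  exists u : 'rV[R]_m, u != 0 /\ u *m M = 0.
Proof.
move=> nm; exists (nz_row (kermx M)); split; last first.
  by apply/sub_kermxP; exact: nz_row_sub.
rewrite nz_row_eq0 -mxrank_eq0 mxrank_ker -lt0n subn_gt0.
exact: leq_ltn_trans (rank_leq_col M) nm.
Qed.

(** Among [n + 1] indicators in a space spanned by [n] functions there is a linear relation, but on
    a nonnull [A i] it reads off the single coefficient [u 0 i]. *)
Lemma infinite_disjoint_not_findim A : infinite_disjoint mu A -> ~ Linf_findim mu.
Proof.
move=> [tA mA A0] [n [e [Le eP]]].
have /choice[c cP] : forall i : 'I_n.+1, exists c : 'I_n -> R,
    {ae mu, forall x, \1_(A i) x = \sum_(j < n) c j * e j x}.
  by move=> i; apply: eP; exact: Linf_indic.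
have [u [u0 uM]] := left_kernel (\matrix_(i < n.+1, j < n) c i j) (ltnSn n).
have [i ui] : exists i, u 0 i != 0.
  apply: contrapT => nu; case/negP: u0; apply/eqP/rowP => i; rewrite mxE.
  by apply/eqP/negPn/negP => h; apply: nu; exists i.
have all_c : {ae mu, forall x, forall i : 'I_n.+1, \1_(A i) x = \sum_(j < n) c i j * e j x}.
  exact: filter_forall.
have : {ae mu, forall x, ~ A i x}.
  apply: filterS all_c => x xP Ax; case/eqP: ui.
  have : \sum_(k < n.+1) u 0 k * (\1_(A k) x : R) = 0.
    under eq_bigr do rewrite xP mulr_sumr.
    rewrite exchange_big/= big1// => j _.
    have := congr1 (fun N : 'rV_n => N 0 j) uM; rewrite !mxE => uj.
    transitivity ((\sum_(k < n.+1) u 0 k * c k j) * e j x).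
      by rewrite mulr_suml; apply: eq_bigr => k _; rewrite mulrA.
    rewrite (_ : \sum_(k < n.+1) _ = 0) ?mul0r//; apply: etrans uj.
    by apply: eq_bigr => k _; rewrite mxE.
  rewrite (bigD1 i)//= indicE mem_set// mulr1 big1 ?addr0// => k ki.
  rewrite indicE memNset ?mulr0// => Ak; case/negP: ki; apply/eqP/val_inj.
  by apply: (tA _ _ I I); exists x.
move=> [N [mN N0 AN]]; have [+ _] := A0 i.
rewrite (measure_sub0 (mA i) mN _ N0) ?ltxx// => x Ax.
by apply: AN => /= nAx; exact: nAx.
Qed.

(** A weak neighbourhood tests [n] functionals, and some nonzero combination of [n + 1] indicators
    is annihilated by all of them. It can be scaled out of the ball of the modular without leaving
    the neighbourhood. *)
Lemma sigma_p_not_weak A p : infinite_disjoint mu A -> 1 <= p ->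
  ~ (sigma_p mu p `<=` weak_inf mu).
Proof.
move=> [tA mA A0] p1 sw; have p0 : 0 < p by exact: lt_le_trans p1.
have [a [a0 a1 _]] := summable_weight p0 (ltr_pwDr ltr01 (lexx p)).
have [w [Lw w0 wA]] := weight_ex (And3 tA mA A0) a0 a1.
have [_ Uo] := sw _ (sigma_p_ball p1 Lw w0).
have [|n [rho [e [e0 Nrho UU]]]] := Uo (fun=> 0).
  by split; [exact: Linf_cst|rewrite pow_int0].
have /choice[gs gsP] : forall i : 'I_n, exists g, L1 mu g /\
    rho i = (fun h => `|pairing mu h g|)%E by move=> i; exact: Nrho.
pose M := \matrix_(i < n.+1, j < n) pair_int mu \1_(A i) (gs j).
have [u [u0 uM]] := left_kernel M (ltnSn n).
have [i ui] : exists i, u 0 i != 0.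
  apply: contrapT => nu; case/negP: u0; apply/eqP/rowP => i; rewrite mxE.
  by apply/eqP/negPn/negP => h; apply: nu; exists i.
(* Scaled so that [|f|] equals [a i ^ (-1/p)] on [A i], where the modular then already picks up
   1. *)
pose s := (a i `^ (- p^-1)) / `|u 0 i|.
pose f x := \sum_(k < n.+1) s * u 0 k * (\1_(A k) x : R).
have LA k : Linf mu \1_(A k) by exact: Linf_indic.
have Lk (k : 'I_n.+1) : Linf mu (fun x => s * u 0 k * (\1_(A k) x : R)) by exact: LinfZ.
have Lf : Linf mu f by exact: (Linf_sum _ Lk).
have [] := UU f Lf; last first.
  move=> _; apply/negP; rewrite -leNgt.
  have t0 : 0 < a i `^ (- p^-1) by exact: powR_gt0.
  have <- : pow_int mu p (fun x => a i `^ (- p^-1) * \1_(A i) x) w = 1.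
    rewrite pow_int_indic// ?(ltW t0)// wA -powRrM mulNr mulVf ?gt_eqF//.
    by rewrite powR_inv1 ?(ltW (a0 i))// mulVf// gt_eqF.
  apply: le_pair_int => //.
  - by apply: Linf_powR; [exact: ltW|exact: LinfZ].
  - by apply: Linf_powR; first exact: ltW.
  apply: nearW => x; rewrite ge0_ler_powR ?nnegrE ?(ltW p0)//.
  rewrite indicE; case: (boolP (x \in A i)) => xA; last by rewrite mulr0 normr0.
  rewrite mulr1 /f (bigD1 i)//= big1 ?addr0; last first.
    move=> k ki; rewrite indicE memNset ?mulr0// => Ak; case/negP: ki.
    by apply/eqP/val_inj; apply: (tA _ _ I I); exists x; split=> //; rewrite inE in xA.
  rewrite indicE xA mulr1 normrM normrM normfV normr_id.
  by rewrite divfK ?normr_eq0.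
move=> k kn; have [Lg ->] := gsP (Ordinal kn).
rewrite pairingE//; last by apply: LinfB => //; exact: Linf_cst.
rewrite (_ : (fun x => f x - 0) = f); last by apply/funext => x; rewrite subr0.
rewrite pair_int_suml//.
have := congr1 (fun N : 'rV_n => N 0 (Ordinal kn)) uM; rewrite !mxE => uk.
rewrite (eq_bigr (fun j => s * (u 0 j * M j (Ordinal kn)))); last first.
  by move=> j _; rewrite pair_intZl// mxE mulrA.
by rewrite -mulr_sumr uk mulr0 /= normr0 lte_fin.
Qed.

(** The function [f], equal to [a n ^ (-1/q)] on [A n], has [q]-modular exactly 1 for [w]. Its
    [p]-modular for any other weight [w'] is the mass of [A n] divided by
    [a n ^ (p/q) >= k / (n + 2)], and is below [e] for a suitable [n] by [small_mass]. *)
Lemma sigma_q_not_sigma_p A p q : infinite_disjoint mu A -> 1 <= p -> p < q ->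
  ~ (sigma_p mu q `<=` sigma_p mu p).
Proof.
move=> dA p1 pq qp; have p0 : 0 < p by exact: lt_le_trans p1.
have q0 : 0 < q by exact: lt_trans pq.
have [a [a0 a1 [k k0 ak]]] := summable_weight p0 pq.
have [w [Lw w0 wA]] := weight_ex dA a0 a1.
have q1 : 1 <= q by rewrite (le_trans p1)// ltW.
have /(sigma_pP p0)/(_ (fun=> 0))[|w' [Lw' w'0 [e e0 UU]]] := qp _ (sigma_p_ball q1 Lw w0).
  by split; [exact: Linf_cst|rewrite pow_int0].
have [n nP] := small_mass dA Lw' w'0 (mulr_gt0 e0 k0).
have [_ mA _] := dA; pose t := a n `^ (- q^-1); have t0 : 0 <= t by exact: powR_ge0.
pose f x := t * \1_(A n) x.
have Lf : Linf mu f by apply: LinfZ; exact: Linf_indic.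
have [] := UU f Lf; last first.
  move=> _; rewrite pow_int_indic// wA -powRrM mulNr mulVf ?gt_eqF//.
  by rewrite powR_inv1 ?(ltW (a0 n))// mulVf ?gt_eqF// ltxx.
rewrite (_ : (fun x => f x - 0) = f); last by apply/funext => x; rewrite subr0.
rewrite pow_int_indic// -powRrM mulNr mulrC (mulrC q^-1) powRN.
rewrite ltr_pdivrMr ?powR_gt0//; apply: lt_le_trans nP _.
by rewrite -mulrA ler_wpM2l ?(ltW e0).
Qed.

(** The gauges of [tau_mu] ignore the height of a function: [f = 1 / a k] on [A k] has modular 1,
    but its gauge for [E i] is at most the measure of [A k] inside [E i]. *)
Lemma sigma_1_not_tau_mu A : infinite_disjoint mu A -> ~ (sigma_p mu 1 `<=` tau_mu mu).
Proof.
move=> dA st; have [tA mA A0] := dA.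
have [a [a0 a1 _]] := @summable_weight R 1 2 ltr01 (ltr1n R 2).
have [w [Lw w0 wA]] := weight_ex dA a0 a1.
have [_ Uo] := st _ (sigma_p_ball (lexx 1) Lw w0).
have [|n [rho [e [e0 Nrho UU]]]] := Uo (fun=> 0).
  by split; [exact: Linf_cst|rewrite pow_int0].
have /choice[E EP] : forall i : 'I_n, exists E, [/\ measurable E, (mu E < +oo)%E &
    rho i = fun h => (\int[mu]_x (Num.min `|h x| (\1_E x))%R%:E)%E].
  by move=> i; exact: Nrho.
have LE i : L1 mu \1_(E i) by have [? ? _] := EP i; exact: L1_indic.
have w'0 x : 0 <= \sum_(i < n) (\1_(E i) x : R) by exact: sumr_ge0.
have [k kP] := small_mass dA (L1_sum (index_enum 'I_n) LE) w'0 e0.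
pose f x := (a k)^-1 * \1_(A k) x.
have LA : Linf mu \1_(A k) by exact: Linf_indic.
have Lf : Linf mu f by exact: LinfZ.
have aV0 : 0 <= (a k)^-1 by rewrite invr_ge0 ltW.
have [] := UU f Lf; last first.
  by move=> _; rewrite pow_int_indic// wA powRr1// mulVf ?gt_eqF// ltxx.
move=> i ilt; have [mE Eoo ->] := EP (Ordinal ilt).
under eq_integral do rewrite subr0.
have := LE (Ordinal ilt); set Ei := E _ in mE Eoo * => LEi.
have L := L1_min_indic (Linf_meas Lf) mE Eoo.
rewrite (L1E L) lte_fin; apply: le_lt_trans (lt_le_trans kP _); last first.
  by rewrite ler_pdivrMr// ler_peMr ?(ltW e0)// ler1n.
apply: ae_le_Rintegral => //.
  by apply: L1_mul => //; exact: (L1_sum (index_enum 'I_n) LE).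
apply: nearW => x; rewrite /f indicE; case: (boolP (x \in A k)) => xA /=; last first.
  by rewrite mulr0 normr0 mul0r ge_min lexx.
rewrite mul1r ge_min; apply/orP; right; rewrite (bigD1 (Ordinal ilt))//= lerDl.
by apply: sumr_ge0.
Qed.

(** The open unit ball is the witness: the indicators of the unions of the tails of [A] decrease
    pointwise to 0, hence order converge to 0, and all have norm 1. *)
Lemma tau_inf_not_tau_O A : infinite_disjoint mu A -> ~ (tau_inf mu `<=` tau_O mu).
Proof.
move=> [tA mA A0] io.
pose U := [set f | Linf mu f /\ exists2 r : R, r < 1 & {ae mu, forall x, `|f x| <= r}].
have Uinf : tau_inf mu U.
  apply/tau_infP; split=> [f []//|f [Lf [r r1 fr]]].
  have r2 : 0 < (1 - r) / 2 by rewrite divr_gt0// subr_gt0.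
  exists ((1 - r) / 2) => // g Lg gf; split=> //; exists ((1 + r) / 2).
    by rewrite ltr_pdivrMr// mul1r; lra.
  apply: filterS2 fr gf => x h1 h2; have := ler_normD (f x) (g x - f x).
  by rewrite addrCA subrr addr0 => h3; lra.
pose B n := \bigcup_(m in [set m | (n <= m)%N]) A m.
have mB n : measurable (B n) by exact: bigcup_measurable.
have LB n : Linf mu \1_(B n) by exact: Linf_indic.
have [] := (tau_OP (io _ Uinf)).2 (fun n => \1_(B n)) (fun=> 0).
- split; first exact: Linf_cst.
  by exists 0 => //; apply: nearW => x; rewrite normr0.
- exact: LB.
- apply: (@order_cvg_seq _ _ _ _ (fun n => \1_(B n))) => //.
  + exact: Linf_cst.
  + move=> n m t nm; rewrite !indicE ler_nat; case: (boolP (t \in B m)) => // tB.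
    rewrite mem_set//; move: tB; rewrite inE => -[k /= mk Ak]; exists k => //=.
    exact: leq_trans mk.
  + apply: nearW => t e e0; have [[k _ Ak]|nA] := pselect ((\bigcup_i A i) t).
      exists k.+1; rewrite indicE memNset// => -[m /= km Am].
      have mk : m = k by apply: (tA _ _ I I); exists t.
      by move: km; rewrite mk ltnn.
    by exists 0%N; rewrite indicE memNset// => -[m _ Am]; apply: nA; exists m.
  + by move=> n; apply: nearW => t; rewrite subr0 ger0_norm.
move=> n [_ [r r1 [N [mN N0 NP]]]]; have [+ _] := A0 n.
rewrite (measure_sub0 (mA n) mN _ N0) ?ltxx// => x Ax; apply: NP => /=.
rewrite indicE mem_set; last by exists n => //=.
by rewrite normr1 leNgt r1.
Qed.

End Strictness.

(** * Bounded parts in the sigma-finite case *)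

Section BoundedParts.
Context d (T : measurableType d) (R : realType) (mu : {measure set T -> \bar R}).
Implicit Types (f g h : T -> R) (E : set T) (B O : set (T -> R)).

Definition meas_gauge E h : \bar R := \int[mu]_x (Num.min `|h x| (\1_E x))%:E.

(** The detour through exponent 2 is made because [sigma_p_mackey] asks for an exponent above 1. *)
Lemma tau_mu_tau_O : tau_mu mu `<=` tau_O mu.
Proof.
move=> U /tau_mu_sigma_1; have h12 : 1 < 2 :> R by rewrite ltr1n.
move=> /(sigma_p_mono ltr01 (ltW h12)) /(sigma_p_mackey h12).
exact: mackey_tau_O.
Qed.

Lemma min_normD (a b c : R) : 0 <= c ->
  Num.min `|a + b| c <= Num.min `|a| c + Num.min `|b| c.
Proof.
move=> c0; rewrite !minEle; have := ler_normD a b.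
have := normr_ge0 a; have := normr_ge0 b.
by case: ifP => [h1|/negbT]; case: ifP => [h2|/negbT]; case: ifP => [h3|/negbT];
  rewrite -?ltNge => *; lra.
Qed.

Lemma meas_gauge_ball_open E f (e : R) : measurable E -> (mu E < +oo)%E ->
  Linf mu f -> tau_mu mu
    [set g | Linf mu g /\ (meas_gauge E (fun x => (g x - f x)%R) < e%:E)%E].
Proof.
move=> mE Eoo Lf; apply: gauge_ball_open.
- by exists E.
- move=> g h Lg Lh.
  have Lgf := L1_min_indic (Linf_meas (LinfB Lg Lf)) mE Eoo.
  have Lhf := L1_min_indic (Linf_meas (LinfB Lh Lf)) mE Eoo.
  have Lhg := L1_min_indic (Linf_meas (LinfB Lh Lg)) mE Eoo.
  rewrite /meas_gauge (L1E Lgf) (L1E Lhf) (L1E Lhg) -EFinD lee_fin -RintegralD//.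
  apply: ae_le_Rintegral => //; first exact: L1D.
  apply: nearW => x; rewrite (_ : h x - f x = (g x - f x) + (h x - g x)).
    by apply: min_normD.
  by lra.
- by move=> g Lg; apply: integral_ge0 => x _; rewrite lee_fin le_min normr_ge0 /=.
Qed.

(** A Borel-Cantelli argument: the sum of the functions [min |y n| 1_(E n)] is integrable, hence
    finite almost everywhere, so its terms tend to 0; each point lies in [E m] from some [m] on. *)
Lemma ae_cvg_meas_gauge (E : nat -> set T) (y : nat -> T -> R) (a : nat -> R) :
  \bigcup_n E n = setT -> nondecreasing_seq E ->
  (forall n, measurable (E n) /\ (mu (E n) < +oo)%E) ->
  (forall n, measurable_fun setT (y n)) ->
  (forall N, \sum_(n < N) a n <= 1) ->
  (forall n, (meas_gauge (E n) (y n) < (a n)%:E)%E) ->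
  {ae mu, forall x, forall e : R, 0 < e -> exists n, forall m, (n <= m)%N ->
     `|y m x| < e}.
Proof.
move=> ET Emono mE my a1 ya.
pose s n x := Num.min `|y n x| (\1_(E n) x).
have s0 n x : 0 <= s n x by rewrite le_min normr_ge0 /=.
have Ls n : L1 mu (s n) by have [? ?] := mE n; exact: L1_min_indic.
pose S x := (\sum_(n <oo) (s n x)%:E)%E.
have mS : measurable_fun setT S.
  apply: ge0_emeasurable_sum => [k x _ _|k _]; first by rewrite lee_fin.
  exact: measurable_int (Ls k).
have S0 x : (0 <= S x)%E by apply: nneseries_ge0 => n _ _; rewrite lee_fin.
have Sint : mu.-integrable setT S.
  apply/integrableP; split=> //; under eq_integral do rewrite gee0_abs//.
  rewrite /S integral_nneseries//; last 2 first.
  - by move=> n; exact: measurable_int (Ls n).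
  - by move=> n x _; rewrite lee_fin.
  apply: (@le_lt_trans _ _ 1%:E); last by rewrite ltry.
  apply: lime_le.
    by apply: is_cvg_nneseries => n _ _; apply: integral_ge0 => x _; rewrite lee_fin.
  near=> N; apply: (@le_trans _ _ (\sum_(0 <= n < N) (a n)%:E)%E).
    by apply: lee_sum => n _; exact: ltW (ya n).
  by rewrite sumEFin big_mkord lee_fin.
have := integrable_ae measurableT Sint; apply: filterS => x /(_ I) Sx e e0.
have cs : cvgn (series (s ^~ x)).
  apply: nondecreasing_is_cvgn.
    by apply/nondecreasing_seqP => n; rewrite /series/= big_nat_recr//= lerDl.
  exists (fine (S x)) => _ [N _ <-]; rewrite -lee_fin fineK// /series/= -sumEFin.
  by apply: nneseries_lim_ge => n _ _; rewrite lee_fin.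
have [k _ Ek] : (\bigcup_n E n) x by rewrite ET.
(* Below 1 the minimum with the indicator must be attained by [|y m x|]. *)
have e1 : 0 < Num.min e 1 by rewrite lt_min e0 /=.
have /cvgrPdist_lt/(_ _ e1) := cvg_series_cvg_0 cs; move=> [N _ NP].
exists (maxn N k) => m; rewrite geq_max => /andP[Nm km].
have /= := NP m Nm; rewrite sub0r normrN (ger0_norm (s0 m x)) /s.
have Emx : E m x by have /subsetPset := Emono _ _ km; apply.
rewrite indicE mem_set//= lt_min => /andP[h1 h2].
move: h1 h2; rewrite !gt_min => /orP[//|e1'] /orP[h2|]; last by rewrite ltxx.
exact: lt_trans e1'.
Unshelve. all: by end_near. Qed.

(** Otherwise there are points [x n] of [B] outside [O] within the summable distance [a n] of [f] on
    the exhausting sets [E n]. They converge almost everywhere, and boundedness makes this order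
    convergence to a point of [O]. *)
Lemma tau_O_bounded_nbhd B O f : sigma_finite setT mu -> Linf_bounded mu B ->
  tau_O mu O -> O f -> B f ->
  exists E, [/\ measurable E, (mu E < +oo)%E & exists2 e : R, 0 < e &
    forall g, B g -> (meas_gauge E (fun x => (g x - f x)%R) < e%:E)%E -> O g].
Proof.
move=> /sigma_finiteP[E [ET Emono mE]] [BL [M0 BM0]] /tau_OP[OL Oc] Of Bf.
pose M := `|M0|; have M_ge0 : 0 <= M by exact: normr_ge0.
have BM g : B g -> {ae mu, forall x, `|g x| <= M}.
  move=> Bg; apply/normInf_leP => //; apply: le_trans (BM0 _ Bg) _.
  by rewrite lee_fin ler_norm.
have h12 : 1 < 2 :> R by rewrite ltr1n.
have [a [a0 a1 _]] := summable_weight ltr01 h12.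
apply: contrapT => nE.
have /choice[x xP] : forall n, exists g, [/\ B g,
    (meas_gauge (E n) (fun t => (g t - f t)%R) < (a n)%:E)%E & ~ O g].
  move=> n; apply: contrapT => ng; apply: nE; exists (E n); have [mEn Eoo] := mE n.
  split=> //; exists (a n) => // g Bg gn; apply: contrapT => nO; apply: ng.
  by exists g.
have Lf := BL _ Bf.
have Bx n : B (x n) by have [] := xP n.
have xg n : (meas_gauge (E n) (fun t => (x n t - f t)%R) < (a n)%:E)%E.
  by have [] := xP n.
have Lx n : Linf mu (x n) by exact: BL.
have Ly n : Linf mu (fun t => x n t - f t) by exact: LinfB.
(* The cap [2 M] holds almost everywhere on [B] anyway; imposing it pointwise lets the tail suprema
   [u n], the gaps of the order convergence, exist everywhere and be bounded. *)
pose y n t := Num.min `|x n t - f t| (2 * M).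
have MM : 0 <= 2 * M by rewrite mulr_ge0.
have y0 n t : 0 <= y n t by rewrite le_min normr_ge0.
have yM n t : y n t <= 2 * M by rewrite ge_min lexx orbT.
have yub t : has_ubound (range (y ^~ t)) by exists (2 * M) => _ [n _ <-].
have dub t n : has_ubound (sdrop (y ^~ t) n) by exists (2 * M) => _ [m _ <-].
pose u n t := sups (y ^~ t) n.
have yu n m t : (n <= m)%N -> y m t <= u n t.
  by move=> nm; apply: (ub_le_sup (dub t n)); exists m.
have uub n t (e : R) : (forall m, (n <= m)%N -> y m t <= e) -> u n t <= e.
  move=> ye; apply: ge_sup; first by exists (y n t), n => /=.
  by move=> _ [m /= nm <-]; exact: ye.
have u0 n t : 0 <= u n t by apply: le_trans (yu n n t (leqnn n)).
have mu_ n : measurable_fun setT (u n).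
  apply: measurable_fun_sups => [t _|m]; first exact: yub.
  apply: measurable_minr => //.
  exact: Linf_meas (Linf_norm (Ly m)).
have Lu n : Linf mu (u n).
  apply: (@Linf_bound _ _ _ _ _ (2 * M)) => // t.
  by rewrite ger0_norm//; apply: uub.
have [] := Oc x f Of Lx; last by move=> n; have [] := xP n.
apply: (order_cvg_seq Lf Lu u0).
- move=> n m t nm; apply: uub => k mk; apply: yu; exact: leq_trans nm mk.
- have := @ae_cvg_meas_gauge E (fun n t => x n t - f t) a (esym ET) Emono mE
    (fun n => Linf_meas (Ly n)) a1 xg.
  apply: filterS => t tP e e0.
  have e2 : 0 < e / 2 by rewrite divr_gt0.
  have [n nP] := tP _ e2; exists n; apply: (@le_lt_trans _ _ (e / 2)); last by lra.
  by apply: uub => m nm; rewrite ge_min (ltW (nP m nm)).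
- move=> n; apply: filterS2 (BM _ (Bx n)) (BM _ Bf) => t h1 h2.
  apply: le_trans (yu n n t (leqnn n)); rewrite le_min lexx /=.
  by rewrite (le_trans (ler_normB _ _))// mulr_natl mulr2n lerD.
Qed.

Lemma trace_tau_mu_tau_O B : sigma_finite setT mu -> Linf_bounded mu B ->
  trace_top (tau_mu mu) B = trace_top (tau_O mu) B.
Proof.
move=> sf BB; apply/seteqP; split=> V [W [Oo ->]].
  by exists W; split=> //; exact: tau_mu_tau_O.
have OL := (tau_OP Oo).1.
(* The union of all measure balls, centred at points of both [W] and [B], whose trace on [B] stays
   inside [W]. *)
pose W' := [set g | exists f E (e : R), [/\ W f, B f, measurable E /\ (mu E < +oo)%E,
  forall h, B h -> (meas_gauge E (fun x => (h x - f x)%R) < e%:E)%E -> W h &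
  Linf mu g /\ (meas_gauge E (fun x => (g x - f x)%R) < e%:E)%E]].
exists W'; split; last first.
  apply/seteqP; split=> g [Og Bg]; split=> //; last first.
    by have [f [E [e [_ _ _ EO [_ ge]]]]] := Og; exact: EO.
  have [E [mE Eoo [e e0 EO]]] := tau_O_bounded_nbhd sf BB Oo Og Bg.
  exists g, E, e; split=> //; split; first exact: OL.
  rewrite /meas_gauge; under eq_integral => x _.
    rewrite subrr normr0 (min_idPl _); last by rewrite indicE.
    over.
  by rewrite integral0 lte_fin.
split; first by move=> g [f [E [e [_ _ _ _ []]]]].
move=> g [f [E [e [Of Bf [mE Eoo] EO Lge]]]].
have [_ /(_ _ Lge)[n [rho [r [r0 Nrho UU]]]]] :=
  @meas_gauge_ball_open E f e mE Eoo (OL _ Of).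
exists n, rho, r; split=> // h Lh hr; exists f, E, e; split=> //.
exact: UU.
Qed.

End BoundedParts.

Theorem mainTheorem8 (d : measure_display) (T : measurableType d) (R : realType)
    (mu : {measure set T -> \bar R}) :
  semi_finite mu ->
  (* (i) *)
  (forall p q : R, 1 <= p -> p < q ->
     [/\ coarser (weak_inf mu) (sigma_p mu p),
         coarser (sigma_p mu p) (sigma_p mu q),
         coarser (sigma_p mu q) (mackey mu),
         coarser (mackey mu) (tau_inf mu) &
         coarser (tau_mu mu) (sigma_p mu p)] /\
        (~ Linf_findim mu ->
         [/\ strictly_coarser (weak_inf mu) (sigma_p mu p),
             strictly_coarser (sigma_p mu p) (sigma_p mu q),
             strictly_coarser (sigma_p mu q) (mackey mu),
             strictly_coarser (mackey mu) (tau_inf mu) &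
             strictly_coarser (tau_mu mu) (sigma_p mu p)])) /\
  (* (ii) *)
  [/\ coarser (mackey mu) (tau_O mu),
      coarser (tau_O mu) (tau_inf mu) &
      (tau_O mu = tau_inf mu <-> Linf_findim mu)] /\
  (* (iii) *)
  (sigma_finite setT mu ->
     forall B : set (T -> R), Linf_bounded mu B ->
       trace_top (tau_mu mu) B = trace_top (tau_O mu) B).
Proof.
move=> sf.
have infdim : ~ Linf_findim mu -> exists A : nat -> set T, infinite_disjoint mu A.
  move=> nfd; apply: infinite_disjoint_ex => // /finitely_atomic_findim.
  exact: nfd.
have mackey_inf : mackey mu `<=` tau_inf mu.
  exact: subset_trans (@mackey_tau_O _ _ _ mu) (@tau_O_tau_inf _ _ _ mu).
split; last split; last by move=> sfin B BB; exact: trace_tau_mu_tau_O.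
  move=> p q p1 pq; have p0 : 0 < p by exact: lt_le_trans p1.
  have q1 : 1 < q by exact: le_lt_trans pq.
  have wp : weak_inf mu `<=` sigma_p mu p.
    exact: subset_trans (@weak_inf_sigma_1 _ _ _ mu) (sigma_p_mono ltr01 p1).
  have mp : tau_mu mu `<=` sigma_p mu p.
    exact: subset_trans (@tau_mu_sigma_1 _ _ _ mu) (sigma_p_mono ltr01 p1).
  have ppq : sigma_p mu p `<=` sigma_p mu q by exact: sigma_p_mono (ltW pq).
  have qm : sigma_p mu q `<=` mackey mu by exact: sigma_p_mackey.
  split=> // /infdim[A dA]; split; split=> //.
  - exact: sigma_p_not_weak dA p1.
  - exact: sigma_q_not_sigma_p dA p1 pq.
  (* The topology [sigma_p] of exponent [q + 1] lies strictly above that of exponent [q] and still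
     below the Mackey topology. *)
  - have qq : q < q + 1 by rewrite ltrDl.
    move=> mq; apply: (sigma_q_not_sigma_p dA (ltW q1) qq).
    by apply: subset_trans mq; apply: sigma_p_mackey; exact: lt_trans qq.
  - move=> im; apply: (tau_inf_not_tau_O dA).
    exact: subset_trans im (@mackey_tau_O _ _ _ mu).
  - move=> pm; apply: (sigma_1_not_tau_mu dA).
    exact: subset_trans (sigma_p_mono ltr01 p1) pm.
split; [exact: mackey_tau_O|exact: tau_O_tau_inf|split].
  move=> Oinf; apply: contrapT => /infdim[A dA].
  by apply: (tau_inf_not_tau_O dA); rewrite Oinf.
move=> fd; apply/seteqP; split; first exact: tau_O_tau_inf.
(* Finite dimension excludes an infinite disjoint sequence, so the space is finitely atomic; then
   [tau_inf] passes below [tau_O] through exponents 1 and 2 and the Mackey topology. *)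
have fa : finitely_atomic mu setT.
  apply: contrapT => /(infinite_disjoint_ex sf)[A dA].
  exact: infinite_disjoint_not_findim dA fd.
have h12 : 1 < 2 :> R by rewrite ltr1n.
apply: subset_trans (finitely_atomic_tau_inf fa) _.
apply: subset_trans (sigma_p_mono ltr01 (ltW h12)) _.
exact: subset_trans (sigma_p_mackey h12) (@mackey_tau_O _ _ _ mu).
Qed.
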